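(* Let $K$ be an algebraically closed field of characteristic $p>0$, let $s\ge 1$ be an integer, and let $n=sp-1$. Then the $a$-number of the Fermat curve $\mathcal{F}_{sp-1}$ over $K$ is $$a(\mathcal{F}_{sp-1})=\tfrac14\, s(s-1)p(p-1).$$
   Context: For a positive integer $n$ with $p\nmid n$, the Fermat curve $\mathcal{F}_n$ is the nonsingular projective plane curve over $K$ with affine equation $X^n+Y^n+1=0$. For a (projective, irreducible, nonsingular) curve $\mathcal{X}$ over $K$ with separating variable $x$ (i.e. $x\in K(\mathcal{X})\setminus K(\mathcal{X})^p$), every $f\in K(\mathcal{X})$ is uniquely $f=u_0^p+u_1^px+\dots+u_{p-1}^px^{p-1}$ with $u_i\in K(\mathcal{X})$; the Cartier operator is the $1/p$-linear map $\mathcal{C}(f\,dx)=u_{p-1}\,dx$ on differentials (it does not depend on $x$). It maps the $g$-dimensional $K$-space $H^0(\mathcal{X},\Omega^1)$ of holomorphic differentials into itself, where $g$ is the genus. The $a$-number $a(\mathcal{X})$ is the $K$-dimension of the kernel of $\mathcal{C}$ on $H^0(\mathcal{X},\Omega^1)$, equivalently the dimension of the space of exact holomorphic differentials (those of the form $df$, $f\in K(\mathcal{X})$). *)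

(* Defs.v *)
From HB Require Import structures.
From mathcomp Require Import all_boot all_order all_algebra.
From mathcomp Require Export mpoly.

Set Implicit Arguments.
Unset Strict Implicit.
Unset Printing Implicit Defensive.

Import GRing.Theory.
Local Open Scope ring_scope.

(* A projective plane curve over K is given by a form F in 'X_0, 'X_1, 'X_2;
   the affine coordinates are X = 'X_0 / 'X_2 and Y = 'X_1 / 'X_2. *)

Definition fermat_form (K : fieldType) (n : nat) : {mpoly K[3]} :=
  'X_(inord 0) ^+ n + 'X_(inord 1) ^+ n + 'X_(inord 2) ^+ n.

Definition on_curve (K : fieldType) (F : {mpoly K[3]}) (P : 'I_3 -> K) : Prop :=
  (exists i, P i != 0) /\ F.@[P] = 0.

Section FunctionField.

Variables (K L : fieldType) (iota : {rmorphism K -> L}) (x y : L).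

(* The value of a form at the generic point (x : y : 1). *)
Definition generic_val (G : {mpoly K[3]}) : L :=
  mmap iota (tnth [tuple x; y; 1]) G.

(* L, with K embedded by iota and with the coordinate functions x and y, is
   the function field of the irreducible curve F = 0 (other than the line
   'X_2 = 0): its elements are the quotients of forms of equal degree, and a
   form vanishes on the curve iff F divides it.  This determines
   (L, iota, x, y) up to a unique isomorphism.  For fermat_form K n with n > 0
   prime to the characteristic of K, the fraction field of
   K[X, Y] / (X^n + Y^n + 1) is such an L. *)
Definition is_function_field (F : {mpoly K[3]}) : Prop :=
  (forall m G, G \is m.-homog ->
     generic_val G = 0 <-> exists Q : {mpoly K[3]}, G = Q * F) /\
  (forall z : L, exists m G H,
     [/\ G \is m.-homog, H \is m.-homog, generic_val H != 0
       & z = generic_val G / generic_val H]).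

(* The local ring at the point with homogeneous coordinates P.  If P is on the
   curve, then H.@[P] != 0 implies generic_val H != 0. *)
Definition local_ring (P : 'I_3 -> K) (z : L) : Prop :=
  exists m G H,
    [/\ G \is m.-homog, H \is m.-homog, H.@[P] != 0
      & z = generic_val G / generic_val H].

End FunctionField.

Section Differentials.

Variables (K L : fieldType) (iota : {rmorphism K -> L}).

Definition derivation (M : lmodType L) (D : L -> M) : Prop :=
  [/\ forall a b, D (a + b) = D a + D b,
      forall a b, D (a * b) = a *: D b + b *: D a
    & forall c, D (iota c) = 0].

Variables (Omega : lmodType L) (d : L -> Omega).

(* (Omega, d) is the module of Kaehler differentials of L over K. *)
Definition is_differentials : Prop :=
  derivation d /\
  forall (M : lmodType L) (D : L -> M), derivation D ->
    exists phi : {linear Omega -> M},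
      (forall f, phi (d f) = D f) /\
      (forall psi : {linear Omega -> M},
         (forall f, psi (d f) = D f) -> psi =1 phi).

Definition regular_at (x y : L) (P : 'I_3 -> K) (w : Omega) : Prop :=
  exists m (f g : 'I_m -> L),
    (forall i, local_ring iota x y P (f i) /\ local_ring iota x y P (g i)) /\
    w = \sum_(i < m) f i *: d (g i).

Definition holomorphic (F : {mpoly K[3]}) (x y : L) (w : Omega) : Prop :=
  forall P, on_curve F P -> regular_at x y P w.

Definition separating (p : nat) (t : L) : Prop := ~ exists u : L, t = u ^+ p.

(* The graph of the Cartier operator: cartier p w w' means C(w) = w'.  The
   value C(w) does not depend on the separating variable t. *)
Definition cartier (p : nat) (w w' : Omega) : Prop :=
  exists (t : L) (u : 'I_p -> L) (j : 'I_p),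
    [/\ separating p t, (j : nat) = p.-1,
        w = (\sum_(i < p) u i ^+ p * t ^+ i) *: d t
      & w' = u j *: d t].

Definition has_dim (S : Omega -> Prop) (a : nat) : Prop :=
  exists b : 'I_a -> Omega,
    (forall c : 'I_a -> K,
       \sum_(i < a) iota (c i) *: b i = 0 -> forall i, c i = 0) /\
    (forall w, S w <-> exists c : 'I_a -> K, w = \sum_(i < a) iota (c i) *: b i).

(* a is the a-number of the curve F = 0 over K, of characteristic p. *)
Definition is_a_number (p : nat) (F : {mpoly K[3]}) (x y : L) (a : nat) : Prop :=
  has_dim (fun w => holomorphic F x y w /\ cartier p w 0) a.

End Differentials.

(* Main.v *)
(** Put n = s p - 1 and w0 = dx / y^(n-1).

    A differential f w0 is holomorphic iff f is a form of degree n - 3 in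
    (x, y, 1): an integral equation of a denominator of f over K[x] shows that
    f becomes a form after multiplication by finitely many lines through
    (0 : 1 : 0), and the local conditions on f at the points of such a line
    allow to cancel that line.  So the monomials x^(a-1) y^(b-1) w0 with
    a, b >= 1 and a + b <= n - 1 are a basis of the holomorphic differentials.

    A differential is killed by the Cartier operator iff it is exact.  Since
    -y^n = 1 + x^n = (x + x^(sp)) / x, with a0 = a mod p and b0 = b mod p one has
      x^(a-1) y^(b-1) w0 = W^p x^(a0+b0) (- x - x^(sp))^(p-1-b0) dx
    where W is a monomial in x, y and their inverses.  Expanding the binomial,
    the coefficient of x^(p-1) dx modulo exact terms is, up to sign,
    'C(p-1-b0, a0) times the p-th power of a monomial; it vanishes iff
    a0 + b0 >= p, and different (a, b) give different monomials.  Hence the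
    kernel is spanned by the (a, b) with a0 + b0 >= p, which are counted through
    the base-p digits: 'C(s, 2) choices of the quotients and 'C(p, 2) of the
    remainders. *)

Require Import Defs.
From HB Require Import structures.
From mathcomp Require Import all_boot all_order all_algebra.
From mathcomp Require Import ring zify.
From Stdlib Require ClassicalEpsilon.

Set Implicit Arguments.
Unset Strict Implicit.
Unset Printing Implicit Defensive.

Import GRing.Theory.
Local Open Scope ring_scope.

(** * Polynomials in several variables and their homogeneous parts *)

Lemma mpoly_alg_ind (R : comNzRingType) n (P : {mpoly R[n]} -> Prop) :
  (forall c, P c%:MP) -> (forall i, P 'X_i) ->
  (forall p q, P p -> P q -> P (p + q)) ->
  (forall p q, P p -> P q -> P (p * q)) -> forall p, P p.
Proof.
move=> PC PX PD PM; elim/mpolyind => [|c m p _ _ Pp].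
  by rewrite -mpolyC0.
apply: PD Pp; rewrite -mul_mpolyC; apply: (PM) => //.
rewrite mpolyXE_id; apply: (big_ind P) => [||i _]; [exact: PC 1 | exact: PM |].
by elim: (m i) => [|k IH]; [exact: PC 1 | rewrite exprS; apply: PM].
Qed.

Lemma eq_rmorph_mpoly (R : comNzRingType) n (S : nzRingType)
    (f g : {rmorphism {mpoly R[n]} -> S}) :
  (forall c, f c%:MP = g c%:MP) -> (forall i, f 'X_i = g 'X_i) -> f =1 g.
Proof.
move=> fgC fgX p; elim/mpoly_alg_ind: p => // p q fgp fgq.
  by rewrite !rmorphD fgp fgq.
by rewrite !rmorphM fgp fgq.
Qed.

(** With [c] the inverse of a coordinate, this dehomogenizes [G] in an affine chart. *)
Lemma mmap_homog_scale n (R : nzRingType) (S : comNzRingType)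
    (f : {rmorphism R -> S}) (h : 'I_n -> S) (c : S) d (G : {mpoly R[n]}) :
  G \is d.-homog -> mmap f (fun i => c * h i) G = c ^+ d * mmap f h G.
Proof.
move/dhomogP=> homG; rewrite /mmap mulr_sumr !big_seq.
apply: eq_bigr => m /homG <-; rewrite mulrCA; congr (_ * _).
rewrite /mmap1. under eq_bigr do rewrite exprMn.
by rewrite big_split /= prodrXr -[(\sum_i _)%N](mdegE m).
Qed.

Lemma pihomogM n (R : comNzRingType) e d (p q : {mpoly R[n]}) :
  p \is e.-homog -> pihomog mdeg (e + d) (p * q) = p * pihomog mdeg d q.
Proof.
move=> homp; elim/mpolyind: q => [|c m q _ _ IH]; first by rewrite !(mulr0, raddf0).
rewrite mulrDr !raddfD /= IH mulrDr; congr (_ + _).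
rewrite -scalerAr !linearZ /= -scalerAr; congr (_ *: _).
have homM : p * 'X_[m] \is (e + mdeg m).-homog by rewrite dhomogM // dhomogX.
rewrite pihomogX; case: eqP => [<-|/eqP neq]; first exact: pihomog_dE.
by rewrite mulr0 (pihomog_ne0 _ homM) // eqn_add2l.
Qed.

Lemma pihomogM_lt n (R : comNzRingType) e d (p q : {mpoly R[n]}) :
  p \is e.-homog -> (d < e)%N -> pihomog mdeg d (p * q) = 0.
Proof.
move=> homp ltde; elim/mpolyind: q => [|c m q _ _ IH]; first by rewrite !(mulr0, raddf0).
rewrite mulrDr !raddfD /= IH addr0 -scalerAr !linearZ /=.
have homM : p * 'X_[m] \is (e + mdeg m).-homog by rewrite dhomogM // dhomogX.
rewrite (pihomog_ne0 _ homM) ?scaler0 //.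
by apply: contraTneq ltde => <-; rewrite -leqNgt leq_addr.
Qed.

(** Only the component of [q] of degree [d - e] contributes to a form of degree [d]. The last clause
    covers the truncation of [d - e]. *)
Lemma homog_quotient n (R : comNzRingType) e d (p q : {mpoly R[n]}) :
  p \is e.-homog -> p * q \is d.-homog ->
  exists r, [/\ p * q = p * r, r \is (d - e).-homog & (d < e)%N -> r = 0].
Proof.
move=> homp /pihomog_dE pqE; case: (ltnP d e) => [ltde|leed].
  by exists 0; rewrite rpred0 mulr0 -pqE (pihomogM_lt _ homp).
exists (pihomog mdeg (d - e) q);
by rewrite pihomogP -(pihomogM _ _ homp) subnKC.
Qed.

Lemma ord3E (i : 'I_3) : [\/ i = inord 0, i = inord 1 | i = inord 2].
Proof.
case: i => [[|[|[|//]]] lti]; [apply: Or31|apply: Or32|apply: Or33];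
  by apply: val_inj; rewrite /= inordK.
Qed.

Lemma tnth3E (T : Type) (a b c : T) :
  (tnth [tuple a; b; c] (inord 0) = a) * (tnth [tuple a; b; c] (inord 1) = b) *
  (tnth [tuple a; b; c] (inord 2) = c).
Proof. by rewrite !(tnth_nth a) !inordK. Qed.

Lemma ord3_sumn (F : 'I_3 -> nat) :
  (\sum_i F i = F (inord 0) + F (inord 1) + F (inord 2))%N.
Proof.
rewrite !big_ord_recr big_ord0 /= add0n.
by congr (F _ + F _ + F _)%N; apply: val_inj; rewrite /= inordK.
Qed.

Lemma mdeg3 (u : 'X_{1..3}) :
  mdeg u = (u (inord 0) + u (inord 1) + u (inord 2))%N.
Proof. by rewrite -[LHS]/(mdeg u) mdegE ord3_sumn. Qed.

Lemma mmap1_tnth3 (S : comNzRingType) (a b c : S) (m : 'X_{1..3}) :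
  mmap1 (tnth [tuple a; b; c]) m =
  a ^+ m (inord 0) * b ^+ m (inord 1) * c ^+ m (inord 2).
Proof.
rewrite /mmap1 !big_ord_recr big_ord0 /= mul1r !(tnth_nth a) /=.
by congr (_ ^+ m _ * _ ^+ m _ * _ ^+ m _); apply: val_inj; rewrite /= inordK.
Qed.

Lemma homogX n (R : nzRingType) (i : 'I_n) : ('X_i : {mpoly R[n]}) \is 1.-homog.
Proof. by rewrite dhomogX; apply/eqP; exact: mdeg1. Qed.

Lemma homogXn n (R : nzRingType) (i : 'I_n) k :
  ('X_i ^+ k : {mpoly R[n]}) \is k.-homog.
Proof. by have := dhomogMn k (homogX R i); rewrite mul1n. Qed.

Lemma homogC n (R : nzRingType) (c : R) : (c%:MP : {mpoly R[n]}) \is 0.-homog.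
Proof. by rewrite -[c%:MP]mulr1 mul_mpolyC rpredZ // dhomog1. Qed.

(** * Forms restricted to the lines through (0 : 1 : 0) *)

Section Line.

Variables (K : fieldType) (a c al be : K).
Hypothesis abc : al * a + be * c = 1.

Local Notation X0 := ('X_(inord 0) : {mpoly K[3]}).
Local Notation X1 := ('X_(inord 1) : {mpoly K[3]}).
Local Notation X2 := ('X_(inord 2) : {mpoly K[3]}).

(** By [abc], [line] and [coline] are a basis of the linear forms in [X0] and [X2]: the determinant
    is [al * a + be * c = 1]. *)
Definition line : {mpoly K[3]} := c%:MP * X0 - a%:MP * X2.
Definition coline : {mpoly K[3]} := al%:MP * X0 + be%:MP * X2.

(* [restr] evaluates at the points (a : Y : c) of [line]; there [coline] is 1,
   so that [extend m] homogenizes a polynomial in Y to degree m. *)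
Definition restr (G : {mpoly K[3]}) : {poly K} :=
  mmap polyC (tnth [tuple a%:P; 'X; c%:P]) G.

HB.instance Definition _ := GRing.RMorphism.copy restr
  (mmap (@polyC K) (tnth [tuple a%:P; 'X; c%:P])).

Definition extend m (q : {poly K}) : {mpoly K[3]} :=
  \sum_(j < m.+1) q`_j *: (X1 ^+ j * coline ^+ (m - j)).

Lemma line_homog : line \is 1.-homog.
Proof. by rewrite rpredB // mul_mpolyC rpredZ // homogX. Qed.

Lemma coline_homog : coline \is 1.-homog.
Proof. by rewrite rpredD // mul_mpolyC rpredZ // homogX. Qed.

Lemma extend_homog m q : extend m q \is m.-homog.
Proof.
apply: rpred_sum => j _; apply: rpredZ.
have := dhomogM (homogXn K (inord 1) j) (dhomogMn (m - j) coline_homog).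
by rewrite mul1n subnKC // -ltnS.
Qed.

Lemma restrX : (restr X0 = a%:P) * (restr X1 = 'X) * (restr X2 = c%:P).
Proof. by rewrite /restr !mmapX !mmap1U !tnth3E. Qed.

Lemma restrC k : restr k%:MP = k%:P.
Proof. exact: mmapC. Qed.

Lemma restr_coline : restr coline = 1.
Proof. by rewrite rmorphD !rmorphM /= !restrC !restrX -!polyCM -polyCD abc. Qed.

Lemma restr_extend m (q : {poly K}) : (size q <= m.+1)%N -> restr (extend m q) = q.
Proof.
move=> leqm; rewrite /extend rmorph_sum /=.
under eq_bigr => j _ do
  rewrite -mul_mpolyC !rmorphM !rmorphXn /= restr_coline restrC restrX expr1n mulr1 mul_polyC.
rewrite -poly_def; apply/polyP => i; rewrite coef_poly ltnS.
by case: ltnP => // lti; rewrite nth_default // (leq_trans leqm).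
Qed.

Lemma restr_hornerE G b : (restr G).[b] = G.@[tnth [tuple a; b; c]].
Proof.
rewrite -[LHS]/((horner_eval b \o restr) G).
apply: (@eq_rmorph_mpoly _ _ _ _ (meval (tnth [tuple a; b; c]))) => [k|i] /=.
  by rewrite restrC mevalC /horner_eval hornerC.
rewrite mevalXU /horner_eval.
by case: (ord3E i) => ->; rewrite restrX tnth3E ?hornerC ?hornerX.
Qed.

(** Since [X0 - a coline = be line] and [X2 - c coline = - al line], the substitution is the
    identity modulo [line]. *)
Lemma line_quotient G : exists Q,
  G = line * Q + mmap (@mpolyC 3 K) (tnth [tuple a%:MP * coline; X1; c%:MP * coline]) G.
Proof.
pose phi : {rmorphism {mpoly K[3]} -> {mpoly K[3]}} :=
  mmap (@mpolyC 3 K) (tnth [tuple a%:MP * coline; X1; c%:MP * coline]).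
rewrite -/(phi G); elim/mpoly_alg_ind: G => [k|i|G H [P GE] [Q HE]|G H [P GE] [Q HE]].
- by exists 0; rewrite /phi mmapC mulr0 add0r.
- have abC : al%:MP * a%:MP + be%:MP * c%:MP = 1 :> {mpoly K[3]}.
    by rewrite -!mpolyCM -mpolyCD abc.
  rewrite /phi mmapX mmap1U; case: (ord3E i) => ->; rewrite tnth3E.
  + exists be%:MP; rewrite /line /coline -[LHS]mul1r -abC; ring.
  + by exists 0; rewrite mulr0 add0r.
  + exists (- al%:MP); rewrite /line /coline -[LHS]mul1r -abC; ring.
- by exists (P + Q); rewrite rmorphD /= {1}GE {1}HE; ring.
exists (P * H + phi G * Q); rewrite rmorphM /= mulrDr {1}GE {1 2}HE; ring.
Qed.

Lemma restr_monomial k (u : 'X_{1..3}) :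
  k%:P * mmap1 (tnth [tuple a%:P; 'X; c%:P]) u =
  (k * a ^+ u (inord 0) * c ^+ u (inord 2)) *: 'X^(u (inord 1)).
Proof. by rewrite mmap1_tnth3 -!rmorphXn /= -mul_polyC !polyCM; ring. Qed.

Lemma extend_is_linear m : linear (extend m).
Proof.
move=> k p q; rewrite /extend scaler_sumr -big_split; apply: eq_bigr => j _.
by rewrite coefD coefZ scalerDl scalerA.
Qed.

HB.instance Definition _ m :=
  GRing.isLinear.Build K {poly K} {mpoly K[3]} _ (extend m) (extend_is_linear m).

Lemma extendXn m j : (j <= m)%N -> extend m 'X^j = X1 ^+ j * coline ^+ (m - j).
Proof.
rewrite -ltnS => ltjm; rewrite /extend (bigD1 (Ordinal ltjm)) //= coefXn eqxx.
rewrite scale1r big1 ?addr0 // => i; rewrite coefXn -val_eqE /=.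
by move=> /negPf ->; rewrite scale0r.
Qed.

Lemma mmap_coline m G : G \is m.-homog ->
  mmap (@mpolyC 3 K) (tnth [tuple a%:MP * coline; X1; c%:MP * coline]) G =
  extend m (restr G).
Proof.
move/dhomogP=> homG; rewrite /restr /mmap raddf_sum /= !big_seq.
apply: eq_bigr => u /homG; rewrite [LHS]mdeg3 => udeg.
have udeg3 : (m - u (inord 1) = u (inord 0) + u (inord 2))%N.
  by rewrite -udeg addnAC addnK.
have le1m : (u (inord 1) <= m)%N by rewrite -udeg addnAC leq_addl.
rewrite restr_monomial mmap1_tnth3.
rewrite linearZ /= extendXn // udeg3 -mul_mpolyC !mpolyCM !rmorphXn /= !exprMn exprD; ring.
Qed.

Lemma line_division m G : G \is m.-homog -> exists Q,
  [/\ G = line * Q + extend m (restr G), Q \is m.-1.-homog & m = 0%N -> Q = 0].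
Proof.
move=> homG; have [Q] := line_quotient G; rewrite (mmap_coline homG) => GE.
have hom : line * Q \is m.-homog.
  have -> : line * Q = G - extend m (restr G) by rewrite {1}GE addrK.
  by rewrite rpredB ?extend_homog.
have [R [QE Rhom R0]] := homog_quotient line_homog hom.
by exists R; rewrite -QE -subn1; split=> // m0; rewrite R0 ?m0.
Qed.

Lemma size_restr m G : G \is m.-homog -> (size (restr G) <= m.+1)%N.
Proof.
move/dhomogP=> homG; rewrite /restr /mmap big_seq.
apply: (leq_trans (size_sum _ _ _)); apply/bigmax_leqP_seq => u _ /homG udeg.
rewrite restr_monomial (leq_trans (size_scale_leq _ _)) // size_polyXn ltnS.
by move: udeg; rewrite [LHS]mdeg3 => <-; rewrite addnAC leq_addl.
Qed.

End Line.

(** * Global sections on the Fermat curve *)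

(** If [q] divided by its gcd with [g] were not constant, it would have a root [b]; being prime to
    the cofactor of [g], it would divide [h], which does not vanish at [b]. *)
Lemma closed_local_dvdp (K : closedFieldType) (q g : {poly K}) :
  q != 0 ->
  (forall b, root q b -> exists2 h, ~~ root h b & q %| h * g) ->
  q %| g.
Proof.
move=> q0 loc; pose d := gcdp q g.
have d0 : d != 0 by rewrite gcdp_eq0 (negPf q0).
have qE : q = (q %/ d) * d by rewrite divpK ?dvdp_gcdl.
have cop : coprimep (q %/ d) (g %/ d) by rewrite coprimep_div_gcd ?q0.
have [/size_poly1P[k k0 kE]|/closed_rootP[b rb]] := boolP (size (q %/ d) == 1%N).
  rewrite (@dvdp_trans _ d) ?dvdp_gcdr // qE kE mul_polyC.
  by rewrite dvdpZl.
have [|h /negP hb qhg] := loc b; first by rewrite qE rootM rb.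
have qh : q %/ d %| h.
  by rewrite -(Gauss_dvdpl _ cop) -(dvdp_mul2r _ _ d0) -mulrA !divpK ?dvdp_gcdl ?dvdp_gcdr.
by case: hb; rewrite -dvdp_XsubCl (dvdp_trans _ qh) ?dvdp_XsubCl.
Qed.

Section FermatCurve.

Variables (K : closedFieldType) (n : nat) (n_gt0 : (0 < n)%N).
Variables (L : fieldType) (iota : {rmorphism K -> L}) (x y : L).
Hypothesis Lff : is_function_field iota x y (fermat_form K n).

Local Notation F := (fermat_form K n).
Local Notation val := (generic_val iota x y).
Local Notation X0 := ('X_(inord 0) : {mpoly K[3]}).
Local Notation X1 := ('X_(inord 1) : {mpoly K[3]}).
Local Notation X2 := ('X_(inord 2) : {mpoly K[3]}).

HB.instance Definition _ := GRing.RMorphism.copy val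
  (mmap iota (tnth [tuple x; y; 1])).

Lemma valC c : val c%:MP = iota c.
Proof. exact: mmapC. Qed.

Lemma valX : (val X0 = x) * (val X1 = y) * (val X2 = 1).
Proof. by rewrite /generic_val !mmapX !mmap1U !tnth3E. Qed.

Lemma fermat_homog : F \is n.-homog.
Proof. by rewrite /fermat_form !rpredD ?homogXn. Qed.

Lemma val_fermat : val F = 0.
Proof. by apply/(Lff.1 _ _ fermat_homog); exists 1; rewrite mul1r. Qed.

Lemma fermat_eq : x ^+ n + y ^+ n + 1 = 0.
Proof. by rewrite -val_fermat /fermat_form !rmorphD !rmorphXn /= !valX expr1n. Qed.

Lemma fermat_meval P : F.@[P] = P (inord 0) ^+ n + P (inord 1) ^+ n + P (inord 2) ^+ n.
Proof. by rewrite /fermat_form !rmorphD !rmorphXn /= !mevalXU. Qed.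

Lemma val_neq0 m G P : G \is m.-homog -> F.@[P] = 0 -> G.@[P] != 0 -> val G != 0.
Proof.
move=> homG FP; apply: contraNneq => /(Lff.1 _ _ homG)[Q ->].
by rewrite mevalM FP mulr0.
Qed.

Lemma curve_point a c : exists b, F.@[tnth [tuple a; b; c]] = 0.
Proof.
have /closed_rootP[b] : size ('X^n + (a ^+ n + c ^+ n)%:P) != 1%N.
  by rewrite size_XnaddC // eqSS -lt0n.
rewrite rootE !hornerE /= => /eqP Eb; exists b.
by rewrite fermat_meval !tnth3E -[RHS]Eb; ring.
Qed.

Lemma val_line_neq0 a c al be : al * a + be * c = 1 -> val (line a c) != 0.
Proof.
(* At a point [(be : b : - al)] the form [line] takes the value [al * a + be * c = 1]. *)
move=> abc; have [b Fb] := curve_point be (- al).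
apply: (val_neq0 (line_homog a c) Fb).
rewrite /line rmorphB !rmorphM /= !mevalC !mevalXU !tnth3E.
by rewrite mulrN opprK addrC mulrC [c * _]mulrC abc oner_eq0.
Qed.

Lemma x_neq0 : x != 0.
Proof.
have [b Fb] := curve_point 1 0.
by rewrite -valX (val_neq0 (homogX _ _) Fb) // mevalXU tnth3E oner_eq0.
Qed.

Lemma y_neq0 : y != 0.
Proof.
have [b Fb] := curve_point 1 0.
rewrite -valX (val_neq0 (homogX _ _) Fb) // mevalXU tnth3E.
apply: contra_eq_neq Fb => ->.
by rewrite fermat_meval !tnth3E expr1n !expr0n gtn_eqF ?n_gt0 // !addr0 oner_eq0.
Qed.

Lemma restr_fermat a c : restr a c F = 'X^n + (a ^+ n + c ^+ n)%:P.
Proof.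
rewrite /fermat_form !rmorphD !rmorphXn /= !restrX -!rmorphXn /=; ring.
Qed.

(* If H z is a form G' with H nonzero at a point of the line, then H G - line G'
   is a multiple of F, so that F divides H G on the line.  Hence F divides G
   there, and subtracting a multiple of F makes G divisible by the line. *)
Lemma remove_line a c al be z m G :
  al * a + be * c = 1 -> G \is m.-homog -> val (line a c) * z = val G ->
  (forall b, F.@[tnth [tuple a; b; c]] = 0 ->
     exists k k' H G', [/\ H \is k.-homog, G' \is k'.-homog,
       H.@[tnth [tuple a; b; c]] != 0, (k' + 1 = k + m)%N & val H * z = val G']) ->
  exists G1, [/\ G1 \is m.-1.-homog, z = val G1 & m = 0%N -> z = 0].
Proof.
move=> abc homG zE loc; pose f := restr a c F.
have fE : f = 'X^n + (a ^+ n + c ^+ n)%:P by exact: restr_fermat.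
have size_f : size f = n.+1 by rewrite fE size_XnaddC.
have f0 : f != 0 by rewrite -size_poly_gt0 size_f.
have fG : f %| restr a c G.
  apply: closed_local_dvdp => // b; rewrite rootE restr_hornerE => /eqP Fb.
  have [k [k' [H [G' [homH homG' HP kk HE]]]]] := loc b Fb.
  exists (restr a c H); first by rewrite rootE restr_hornerE.
  have hom : H * G - line a c * G' \is (k + m).-homog.
    apply: rpredB; first exact: dhomogM.
    by rewrite -kk addnC dhomogM // line_homog.
  have /(Lff.1 _ _ hom)[Q QE] : val (H * G - line a c * G') = 0.
    by rewrite rmorphB !rmorphM /= -zE -HE; ring.
  rewrite -rmorphM -[H * G](subrK (line a c * G')) QE rmorphD !rmorphM /=.
  suff -> : restr a c (line a c) = 0 by rewrite mul0r addr0 dvdp_mulIr.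
  by rewrite rmorphB !rmorphM /= !restrC !restrX -!polyCM mulrC subrr.
have [G' [homG' valG' restrG']] : exists G',
    [/\ G' \is m.-homog, val G' = val G & restr a c G' = 0].
  (* For [m < n] there is no multiple of [F] to subtract, but the restriction of [G] has degree
     below that of [f] and is already 0. *)
  have [ltmn|lenm] := ltnP m n.
    exists G; split=> //; apply/eqP; apply: contraTT fG => rG0.
    rewrite gtNdvdp // size_f (leq_ltn_trans (size_restr a c homG)) //.
  have [q qE] := dvdpP _ _ fG.
  have sq : (size q <= (m - n).+1)%N.
    have := size_restr a c homG; rewrite qE.
    have [->|q0] := eqVneq q 0; first by rewrite size_poly0.
    rewrite size_mul // size_f addnS /= -subSn // leq_subRL ?(leqW lenm) // addnC.
    by move=> ->.
  exists (G - F * extend al be (m - n) q); split.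
  - apply: rpredB => //; have := dhomogM fermat_homog (extend_homog al be (m - n) q).
    by rewrite subnKC.
  - by rewrite rmorphB rmorphM /= val_fermat mul0r subr0.
  - by rewrite rmorphB rmorphM /= restr_extend // qE mulrC subrr.
have [Q [GE homQ Q0]] := line_division abc homG'.
have zQ : z = val Q.
  apply: (mulfI (val_line_neq0 abc)).
  by rewrite zE -valG' GE restrG' raddf0 addr0 rmorphM.
by exists Q; split=> // /Q0 Q00; rewrite zQ Q00 rmorph0.
Qed.

(** This is the affine coordinate ring K[x, y]: powers of [X2], of value 1, equalize the degrees. *)
Definition any_form z := exists m G, G \is m.-homog /\ z = val G.

Lemma any_formC c : any_form (iota c).
Proof. by exists 0%N, c%:MP; rewrite homogC valC. Qed.

Lemma any_formM z t : any_form z -> any_form t -> any_form (z * t).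
Proof.
move=> [m [G [homG ->]]] [k [H [homH ->]]].
by exists (m + k)%N, (G * H); rewrite rmorphM dhomogM.
Qed.

Lemma any_formD z t : any_form z -> any_form t -> any_form (z + t).
Proof.
move=> [m [G [homG ->]]] [k [H [homH ->]]].
exists (m + k)%N, (G * X2 ^+ k + X2 ^+ m * H).
split; first by apply: rpredD; rewrite dhomogM ?homogXn.
by rewrite rmorphD !rmorphM !rmorphXn /= valX !expr1n mulr1 mul1r.
Qed.

Definition polyx (q : {poly K}) : L := (map_poly iota q).[x].

HB.instance Definition _ := GRing.RMorphism.copy polyx (horner_eval x \o map_poly iota).

Lemma polyxC c : polyx c%:P = iota c.
Proof. by rewrite /polyx map_polyC /= hornerC. Qed.

Lemma polyxX : polyx 'X = x.
Proof. by rewrite /polyx map_polyX hornerX. Qed.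

Lemma any_form_polyx q : any_form (polyx q).
Proof.
elim/poly_ind: q => [|q c IH]; first by rewrite -polyC0 polyxC; exact: any_formC.
rewrite rmorphD rmorphM /= polyxX polyxC; apply: any_formD (any_formC c).
by apply: any_formM IH _; exists 1%N, X0; rewrite homogX valX.
Qed.

Lemma any_form_horner (q : {poly {poly K}}) h :
  any_form h -> any_form (map_poly polyx q).[h].
Proof.
move=> Ah; elim/poly_ind: q => [|q c IH].
  by rewrite rmorph0 horner0 -(rmorph0 iota); exact: any_formC.
rewrite rmorphD rmorphM /= map_polyX map_polyC hornerMXaddC.
by apply: any_formD (any_form_polyx c); apply: any_formM.
Qed.

Lemma polyx_integral G : integralOver polyx (val G).
Proof.
elim/mpoly_alg_ind: G => [c|i|G H IG IH|G H IG IH].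
- by rewrite valC -polyxC; apply: integral_id.
- have intx : integralOver polyx x by rewrite -polyxX; apply: integral_id.
  case: (ord3E i) => ->; rewrite valX //; last exact: integral1.
  exists ('X^n + ('X^n + 1)%:P); first by rewrite monicXnaddC.
  rewrite rmorphD rmorphXn /= map_polyX map_polyC rootE !hornerE /=.
  by rewrite rmorphD rmorphXn rmorph1 /= polyxX -fermat_eq; apply/eqP; ring.
- by rewrite rmorphD; apply: integral_add.
- by rewrite rmorphM; apply: integral_mul.
Qed.

(** In an integral equation of [h] over K[x], factors of the variable are cancelled until the
    constant coefficient is nonzero; the equation then exhibits this coefficient as a multiple of
    [h]. *)
Lemma norm_multiple h : any_form h -> h != 0 ->
  exists2 B, B != 0 & exists2 t, any_form t & polyx B = h * t.
Proof.
move=> Ah h0; have [m [G [_ hE]]] := Ah.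
have [q qmon] := polyx_integral G; rewrite -hE rootE.
have := monic_neq0 qmon; elim/poly_ind: q {qmon} => [|q c IH]; first by rewrite eqxx.
have [->|c0] := eqVneq c 0; last first.
  move=> _ /eqP; rewrite rmorphD rmorphM /= map_polyX map_polyC hornerMXaddC.
  move=> Ec; exists c => //; exists (- (map_poly polyx q).[h]).
    rewrite -mulN1r; apply: any_formM (any_form_horner _ Ah).
    by rewrite -(rmorphN1 iota); apply: any_formC.
  by apply/eqP; rewrite -subr_eq0 -Ec; apply/eqP; ring.
rewrite addr0 mulf_eq0 negb_or => /andP[q0 _].
by rewrite rmorphM /= map_polyX hornerMX mulf_eq0 (negPf h0) orbF; exact: IH.
Qed.

Definition lines (s : seq (K * K)) : L := \prod_(l <- s) val (line l.1 l.2).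

Lemma line_coline a c : (a != 0) || (c != 0) -> exists al be : K, al * a + be * c = 1.
Proof.
have [-> /= c0|a0 _] := eqVneq a 0; last by exists a^-1, 0; rewrite mulVf // mul0r addr0.
by exists 0, c^-1; rewrite mulVf // mul0r add0r.
Qed.

Lemma lines_neq0 s : all (fun l => (l.1 != 0) || (l.2 != 0)) s -> lines s != 0.
Proof.
move/allP=> sN0; rewrite /lines prodf_seq_neq0; apply/allP => l /sN0 lN0 /=.
by have [al [be /val_line_neq0]] := line_coline lN0.
Qed.

(* The lines (-1, 0) are 'X_2 = 0, of value 1: they only adjust the degree. *)
Lemma any_denominator f : exists s m G,
  [/\ all (fun l => (l.1 != 0) || (l.2 != 0)) s, G \is m.-homog,
      (m + 3 = n + size s)%N & lines s * f = val G].
Proof.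
have [m [G [H [homG homH H0 ->]]]] := Lff.2 f.
have [|B B0 [t At BE]] := @norm_multiple (val H) _ H0; first by exists m, H.
have [rs Brs] := closed_field_poly_normal B.
have lc0 : iota (lead_coef B) != 0 by rewrite fmorph_eq0 lead_coef_eq0.
(* The line [(a, 1)] has value [x - a], so the roots of [B] give its linear factors. *)
pose s := [seq (a, 1) | a <- rs] : seq (K * K).
have sE : iota (lead_coef B) * lines s = val H * t.
  rewrite -BE [in RHS]Brs /lines big_map -mul_polyC rmorphM /= polyxC; congr (_ * _).
  rewrite rmorph_prod /=; apply: eq_bigr => a _.
  by rewrite /line !rmorphB !rmorphM /= !valX !valC polyxX polyxC rmorph1; ring.
have sN0 : all (fun l : K * K => (l.1 != 0) || (l.2 != 0)) s.
  by apply/allP => l /mapP[a _ ->]; rewrite oner_eq0 orbT.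
have [k [G' [homG' G'E]]] : any_form ((iota (lead_coef B))^-1 * (t * val G)).
  rewrite -fmorphV; apply: any_formM; first exact: any_formC.
  by apply: any_formM => //; exists m, G.
have fE : lines s * (val G / val H) = val G'.
  by rewrite -G'E -[lines s](mulKf lc0) sE; field; rewrite lc0 H0.
(* The degree has to be [n - 3 + size s]: either [G'] is padded with powers of [X2], or [s] with
   lines of value 1. *)
have [lek|ltk] := leqP (k + 3) (n + size s).
  exists s, (n + size s - 3)%N, (G' * X2 ^+ (n + size s - (k + 3))).
  split=> //; last by rewrite fE rmorphM rmorphXn /= valX expr1n mulr1.
    have -> : (n + size s - 3 = k + (n + size s - (k + 3)))%N by lia.
    by rewrite dhomogM // homogXn.
  by rewrite subnK // (leq_trans _ lek) ?leq_addl.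
exists (nseq (k + 3 - (n + size s)) (-1, 0) ++ s), k, G'; split=> //.
- by rewrite all_cat sN0 all_nseq /= oppr_eq0 oner_eq0 orbT.
- by rewrite size_cat size_nseq addnCA subnK // ltnW.
rewrite /lines big_cat big_nseq /= -/(lines s) -fE.
have -> : val (line (-1) 0) = 1.
  by rewrite /line rmorphB !rmorphM /= !valX !valC rmorph0 rmorphN1; ring.
by rewrite iter_mulr_1 expr1n mul1r.
Qed.

(** The hypothesis makes [f] a local section of O(n - 3) at every point. Each line removed from the
    denominator lowers the degree of the numerator by one, and degree n - 3 is reached when no line
    is left. *)
Lemma global_sections f :
  (forall P, on_curve F P -> exists k k' H G',
     [/\ H \is k.-homog, G' \is k'.-homog,
         H.@[P] != 0, (k' + 3 = k + n)%N & val H * f = val G']) ->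
  f = 0 \/ exists m G, [/\ G \is m.-homog, (m + 3 = n)%N & f = val G].
Proof.
move=> loc; have [s [m [G []]]] := any_denominator f.
elim: s m G => [|[a c] s IH] m G /=.
  by rewrite addn0 /lines big_nil mul1r => _ homG mn fE; right; exists m, G.
move=> /andP[ac sN0] homG msz; rewrite /lines big_cons -/(lines s) -mulrA => fE.
have [al [be abc]] := line_coline ac.
have [|G1 [homG1 G1E m0]] := remove_line abc homG fE.
  move=> b Fb; have [|k [k' [H [G' [homH homG' HP kk HE]]]]] := loc (tnth [tuple a; b; c]).
    split=> //; case/orP: ac => [a0|c0]; [exists (inord 0)|exists (inord 2)];
      by rewrite tnth3E.
  have [r [B [homB rs BE]]] : exists r B, [/\ B \is r.-homog, r = size s & lines s = val B].
    exists (size s), (\prod_(l <- s) line l.1 l.2); split=> //; last first.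
      exact/esym/(rmorph_prod val).
    elim: (s) => [|l s' IHs]; first by rewrite big_nil dhomog1.
    by rewrite big_cons /= -(add1n (size s')) dhomogM // line_homog.
  exists k, (r + k')%N, H, (B * G'); split=> //; first exact: dhomogM.
    have {}msz : (m + 3 = n + r.+1)%N by rewrite rs.
    lia.
  by rewrite rmorphM /= -BE -HE; ring.
have [meq0|m_gt0] := posnP m.
  left; apply/eqP; move: (m0 meq0) => /eqP.
  by rewrite mulf_eq0 (negPf (lines_neq0 sN0)).
apply: IH sN0 homG1 _ G1E.
by apply: succn_inj; rewrite -addSn prednK // -addnS.
Qed.

End FermatCurve.

Lemma mderivXU n (R : comNzRingType) i j : ('X_j : {mpoly R[n]})^`M(i) = (i == j)%:R.
Proof.
rewrite mderivX mnmE eq_sym; case: eqP => [->|_]; last by rewrite scale0r.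
by rewrite scale1r -mpolyX0; congr 'X_[_]; apply/mnmP => k; rewrite mnmBE mnm0E subnn.
Qed.

(** * Derivations of the function field and holomorphic differentials *)

Section DerivationTheory.

Variables (K L : fieldType) (iota : {rmorphism K -> L}).
Variables (M : lmodType L) (E : L -> M).
Hypothesis derE : derivation iota E.

Lemma derivD a b : E (a + b) = E a + E b. Proof. by case: derE. Qed.

Lemma derivM a b : E (a * b) = a *: E b + b *: E a. Proof. by case: derE. Qed.

Lemma der_const c : E (iota c) = 0. Proof. by case: derE. Qed.

Lemma der0 : E 0 = 0. Proof. by rewrite -{1}(rmorph0 iota) der_const. Qed.

Lemma der1 : E 1 = 0. Proof. by rewrite -(rmorph1 iota) der_const. Qed.

Lemma der_exp a k : E (a ^+ k) = (k%:R * a ^+ k.-1) *: E a.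
Proof.
elim: k => [|k IH]; first by rewrite expr0 der1 mulr0n mul0r scale0r.
rewrite exprS derivM IH scalerA -scalerDl; congr (_ *: _).
rewrite -[k.+1.-1]/k -[k.+1%:R]natr1.
case: k {IH} => [|k]; first by rewrite expr0; ring.
by rewrite -[k.+1.-1]/k exprS; ring.
Qed.

Lemma der_sum I (r : seq I) (P : pred I) (f : I -> L) :
  E (\sum_(i <- r | P i) f i) = \sum_(i <- r | P i) E (f i).
Proof. by apply: big_morph; [exact: derivD | exact: der0]. Qed.

Lemma der_mmap_eq0 n (h : 'I_n -> L) (G : {mpoly K[n]}) :
  (forall i, E (h i) = 0) -> E (mmap iota h G) = 0.
Proof.
move=> Eh0; elim/mpoly_alg_ind: G => [c|i|G H IG IH|G H IG IH].
- by rewrite mmapC der_const.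
- by rewrite mmapX mmap1U.
- by rewrite rmorphD derivD IG IH addr0.
- by rewrite rmorphM derivM IG IH !scaler0 addr0.
Qed.

Lemma der_div_eq0 a b : b != 0 -> E a = 0 -> E b = 0 -> E (a / b) = 0.
Proof.
move=> b0 Ea Eb; have := derivM (a / b) b.
rewrite divfK // Ea Eb scaler0 add0r => /esym/eqP.
by rewrite scaler_eq0 (negPf b0) => /eqP.
Qed.

End DerivationTheory.

Section FunctionDerivation.

Variables (K L : fieldType) (iota : {rmorphism K -> L}) (E : L -> L^o).
Hypothesis derE : derivation iota E.

Lemma der_div a b : b != 0 -> E (a / b) = (E a - a / b * E b) / b.
Proof.
move=> b0; have : E (a / b * b) = E a by rewrite divfK.
by rewrite (derivM derE) /GRing.scale /= => <-; field.
Qed.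

Lemma der_mmap n (h : 'I_n -> L) (G : {mpoly K[n]}) :
  E (mmap iota h G) = \sum_i mmap iota h G^`M(i) * E (h i).
Proof.
elim/mpoly_alg_ind: G => [c|i|G H IG IH|G H IG IH].
- by rewrite mmapC (der_const derE) big1 // => i _; rewrite mderivC rmorph0 mul0r.
- rewrite mmapX mmap1U (bigD1 i) //= big1 ?addr0 => [|j ji].
    by rewrite mderivXU eqxx rmorph1 mul1r.
  by rewrite mderivXU (negPf ji) rmorph0 mul0r.
- rewrite rmorphD (derivD derE) IG IH -big_split; apply: eq_bigr => i _ /=.
  by rewrite raddfD rmorphD mulrDl.
rewrite rmorphM (derivM derE) IG IH /GRing.scale /= !mulr_sumr -big_split.
apply: eq_bigr => i _ /=.
by rewrite mderivM rmorphD !rmorphM /=; ring.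
Qed.

End FunctionDerivation.

(** * The derivation d/dx and the local rings of the Fermat curve *)

Section Local.

Variables (K : closedFieldType) (n : nat) (n_gt0 : (0 < n)%N).
Variables (L : fieldType) (iota : {rmorphism K -> L}) (x y : L).
Hypothesis Lff : is_function_field iota x y (fermat_form K n).

Local Notation F := (fermat_form K n).
Local Notation val := (generic_val iota x y).
Local Notation X0 := ('X_(inord 0) : {mpoly K[3]}).
Local Notation X1 := ('X_(inord 1) : {mpoly K[3]}).
Local Notation X2 := ('X_(inord 2) : {mpoly K[3]}).
Local Notation xyz := (tnth [tuple x; y; 1]).

Let x0 : x != 0 := x_neq0 n_gt0 Lff.
Let y0 : y != 0 := y_neq0 n_gt0 Lff.

(* This is d/dx in the affine coordinates (x, y): it kills F since
   dy/dx = - (x / y)^(n-1). *)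
Definition form_der (G : {mpoly K[3]}) : L :=
  val G^`M(inord 0) - (x / y) ^+ n.-1 * val G^`M(inord 1).

Lemma form_derD G H : form_der (G + H) = form_der G + form_der H.
Proof. by rewrite /form_der !mderivD !rmorphD /=; ring. Qed.

Lemma form_derM G H : form_der (G * H) = val G * form_der H + val H * form_der G.
Proof. by rewrite /form_der !mderivM !rmorphD !rmorphM /=; ring. Qed.

Lemma form_derC c : form_der c%:MP = 0.
Proof. by rewrite /form_der !mderivC !rmorph0; ring. Qed.

Lemma form_derX : (form_der X0 = 1) * (form_der X1 = - (x / y) ^+ n.-1) * (form_der X2 = 0).
Proof.
by rewrite /form_der !mderivXU -!val_eqE /= !inordK //= !rmorph_nat /=; do !split; ring.
Qed.

Lemma form_derXn G k : form_der (G ^+ k) = k%:R * val G ^+ k.-1 * form_der G.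
Proof.
elim: k => [|k IH]; first by rewrite expr0 -mpolyC1 form_derC mulr0n !mul0r.
rewrite exprS form_derM IH rmorphXn -[k.+1.-1]/k -[k.+1%:R]natr1 /=.
case: k {IH} => [|k]; first by rewrite expr0; ring.
by rewrite -[k.+1.-1]/k exprS; ring.
Qed.

Lemma form_der_fermat : form_der F = 0.
Proof.
rewrite /fermat_form !form_derD !form_derXn !form_derX !valX expr_div_n.
by field; rewrite expf_neq0.
Qed.

Lemma form_der_eq0 m G : G \is m.-homog -> val G = 0 -> form_der G = 0.
Proof.
move=> homG /(Lff.1 _ _ homG)[Q ->].
by rewrite form_derM form_der_fermat (val_fermat Lff); ring.
Qed.

(** The quotient rule for [z = G / H], as a relation because [G] and [H] are not determined by
    [z]. *)
Definition der_graph z t := exists m G H,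
  [/\ G \is m.-homog, H \is m.-homog, val H != 0,
      val G = z * val H & t * val H = form_der G - z * form_der H].

(** For two fractions of the same value, [G * H' - G' * H] is a form vanishing on the curve, hence
    killed by [form_der]. *)
Lemma der_graph_unique z t t' : der_graph z t -> der_graph z t' -> t = t'.
Proof.
move=> [m [G [H [homG homH H0 zE tE]]]] [m' [G' [H' [homG' homH' H0' zE' tE']]]].
have hom : G * H' - G' * H \is (m + m').-homog.
  by apply: rpredB; last rewrite addnC; rewrite dhomogM.
have /(form_der_eq0 hom) : val (G * H' - G' * H) = 0.
  by rewrite rmorphB !rmorphM /= zE zE'; ring.
rewrite -mulN1r -[-1](rmorphN1 (@mpolyC 3 K)).
rewrite form_derD !form_derM form_derC rmorphM /= valC rmorphN1 zE zE' => Ez.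
apply: (mulIf H0); apply: (mulIf H0'); rewrite tE mulrAC tE'.
by apply/eqP; rewrite -subr_eq0 -Ez; apply/eqP; ring.
Qed.

Lemma exists_derivation : exists D : L -> L^o,
  [/\ derivation iota D, D x = 1 & D y = - (x / y) ^+ n.-1].
Proof.
have ex z : {t | der_graph z t}.
  apply: ClassicalEpsilon.constructive_indefinite_description.
  have [m [G [H [homG homH H0 ->]]]] := Lff.2 z.
  exists ((form_der G - val G / val H * form_der H) / val H), m, G, H.
  by split=> //; rewrite divfK.
pose D z : L^o := sval (ex z).
have DE z t : der_graph z t -> D z = t by apply: der_graph_unique; exact: svalP.
have graphX G : G \is 1.-homog -> der_graph (val G) (form_der G).
  move=> homG; exists 1%N, G, X2; split=> //; rewrite ?homogX ?valX ?oner_eq0 ?mulr1 //.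
  by rewrite form_derX mulr0 subr0.
exists D; split.
- split=> [a b|a b|c].
  + have [m [G [H [homG homH H0 aE DaE]]]] := svalP (ex a).
    have [m' [G' [H' [homG' homH' H0' bE DbE]]]] := svalP (ex b).
    apply: DE; exists (m + m')%N, (G * H' + H * G'), (H * H').
    rewrite dhomogM // form_derD !form_derM rmorphD !rmorphM /= mulf_neq0 //; split=> //.
    * by rewrite rpredD ?dhomogM.
    * by rewrite aE bE; ring.
    * have -> : (D a + D b) * (val H * val H') =
        D a * val H * val H' + val H * (D b * val H') by ring.
      by rewrite DaE DbE aE bE; ring.
  + have [m [G [H [homG homH H0 aE DaE]]]] := svalP (ex a).
    have [m' [G' [H' [homG' homH' H0' bE DbE]]]] := svalP (ex b).
    apply: DE; exists (m + m')%N, (G * G'), (H * H').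
    rewrite !dhomogM // !form_derM !rmorphM /= mulf_neq0 //; split=> //.
    * by rewrite aE bE; ring.
    * have -> : (a *: D b + b *: D a) * (val H * val H') =
        a * val H * (D b * val H') + b * val H' * (D a * val H).
        by rewrite /GRing.scale /=; ring.
      by rewrite DaE DbE aE bE; ring.
  + apply: DE; exists 0%N, c%:MP, 1; split; rewrite ?homogC ?dhomog1 //.
    * by rewrite rmorph1 oner_eq0.
    * by rewrite valC rmorph1 mulr1.
    * by rewrite -[1]mpolyC1 !form_derC; ring.
- by have := DE _ _ (graphX X0 (homogX _ _)); rewrite valX form_derX.
- by have := DE _ _ (graphX X1 (homogX _ _)); rewrite valX form_derX.
Qed.

Section AtPoint.

Variables (P : 'I_3 -> K) (curveP : on_curve F P).

Local Notation lr := (local_ring iota x y P).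

Let FP : F.@[P] = 0 := curveP.2.

Lemma local_ring_const c : lr (iota c).
Proof.
exists 0%N, c%:MP, 1.
by rewrite homogC dhomog1 meval1 oner_eq0 valC (rmorph1 val) divr1.
Qed.

Lemma local_ringD a b : lr a -> lr b -> lr (a + b).
Proof.
move=> [m [G [H [homG homH HP ->]]]] [k [G' [H' [homG' homH' HP' ->]]]].
exists (m + k)%N, (G * H' + H * G'), (H * H'); split; rewrite ?dhomogM //.
- by apply: rpredD; rewrite dhomogM.
- by rewrite mevalM mulf_neq0.
have := val_neq0 Lff homH FP HP; have := val_neq0 Lff homH' FP HP'.
by rewrite rmorphD !rmorphM /= => ? ?; field; apply/andP.
Qed.

Lemma local_ringM a b : lr a -> lr b -> lr (a * b).
Proof.
move=> [m [G [H [homG homH HP ->]]]] [k [G' [H' [homG' homH' HP' ->]]]].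
exists (m + k)%N, (G * G'), (H * H'); split; rewrite ?dhomogM //.
- by rewrite mevalM mulf_neq0.
by rewrite !rmorphM /= mulf_div.
Qed.

Lemma local_ringN a : lr a -> lr (- a).
Proof. by rewrite -mulN1r -(rmorphN1 iota); apply: local_ringM (local_ring_const _). Qed.

Lemma local_ringX a k : lr a -> lr (a ^+ k).
Proof.
move=> la; elim: k => [|k IH]; last by rewrite exprS; apply: local_ringM.
by rewrite expr0 -(rmorph1 iota); apply: local_ring_const.
Qed.

Lemma local_ring_sum I (r : seq I) (f : I -> L) :
  (forall i, lr (f i)) -> lr (\sum_(i <- r) f i).
Proof.
move=> lf; elim/big_ind: _ => //; last exact: local_ringD.
by rewrite -(rmorph0 iota); apply: local_ring_const.
Qed.

Lemma local_ring_mmap m (h : 'I_m -> L) G : (forall i, lr (h i)) -> lr (mmap iota h G).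
Proof.
move=> lh; elim/mpoly_alg_ind: G => [c|i|G H lG lH|G H lG lH].
- by rewrite mmapC; apply: local_ring_const.
- by rewrite mmapX mmap1U.
- by rewrite rmorphD; apply: local_ringD.
- by rewrite rmorphM; apply: local_ringM.
Qed.

Lemma val_var i : val 'X_i = xyz i.
Proof. by rewrite /generic_val mmapX mmap1U. Qed.

Lemma coord_neq0 k : P k != 0 -> xyz k != 0.
Proof.
by move=> Pk; rewrite -val_var (val_neq0 Lff (homogX _ _) FP) // mevalXU.
Qed.

Lemma local_ring_coord k i : P k != 0 -> lr (xyz i / xyz k).
Proof. by move=> Pk; exists 1%N, 'X_i, 'X_k; rewrite !homogX mevalXU !val_var. Qed.

(** Dividing by powers of the [k]-th coordinate turns [z] into a quotient of polynomials in the
    affine coordinates [h i], with denominator a unit at [P]; the chain and quotient rules then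
    apply. *)
Lemma local_ring_derivation (E : L -> L^o) k : derivation iota E -> P k != 0 ->
  (forall i, lr (E (xyz i / xyz k))) -> forall z, lr z -> lr (E z).
Proof.
move=> derE Pk lE z [m [G [H [homG homH HP ->]]]].
have k0 := coord_neq0 Pk; have H0 := val_neq0 Lff homH FP HP.
pose h i := (xyz k)^-1 * xyz i.
have lh i : lr (h i) by rewrite /h mulrC; apply: local_ring_coord.
have hE A : A \is m.-homog -> mmap iota h A = (xyz k)^-1 ^+ m * val A.
  by move=> homA; rewrite (mmap_homog_scale _ _ _ homA).
have hH0 : mmap iota h H != 0 by rewrite hE // mulf_neq0 // expf_neq0 // invr_eq0.
have lV : lr (mmap iota h H)^-1.
  exists m, ('X_k ^+ m), H; split=> //; first exact: homogXn.
  by rewrite hE // rmorphXn /= val_var exprVn invfM invrK.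
have -> : val G / val H = mmap iota h G / mmap iota h H.
  by rewrite !hE // -mulf_div divff ?mul1r // expf_neq0 // invr_eq0.
have lEh A : lr (E (mmap iota h A)).
  rewrite (der_mmap derE); apply: local_ring_sum => i.
  apply: local_ringM; first exact: local_ring_mmap.
  by rewrite /h mulrC.
rewrite (der_div derE) //; apply: local_ringM => //.
apply: local_ringD => //; apply: local_ringN; apply: local_ringM => //.
by apply: local_ringM => //; apply: local_ring_mmap.
Qed.

(** By the equation, two vanishing coordinates would force the third to vanish. *)
Lemma curve_chart :
  P (inord 2) != 0 /\ (P (inord 0) != 0 \/ P (inord 1) != 0) \/
  P (inord 0) != 0 /\ P (inord 1) != 0.
Proof.
have [[i Pi] _] := curveP; have z0 : (0 : K) ^+ n = 0 by rewrite expr0n gtn_eqF.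
have root0 (a : K) : a ^+ n = 0 -> a = 0 by move/eqP; rewrite expf_eq0 n_gt0 => /eqP.
have allN0 : P (inord 0) = 0 -> P (inord 1) = 0 -> P (inord 2) != 0.
  move=> P0 P1; apply: contraNneq Pi => P2.
  by case: (ord3E i) => ->; rewrite ?P0 ?P1 ?P2.
have := FP; rewrite fermat_meval.
have [P2|P2] := eqVneq (P (inord 2)) 0; last first.
  have [P0|P0] := eqVneq (P (inord 0)) 0; last by left; split=> //; left.
  have [P1|P1] := eqVneq (P (inord 1)) 0; last by left; split=> //; right.
  by rewrite P0 P1 !z0 !add0r => /root0/eqP; rewrite (negPf P2).
rewrite P2 z0 addr0 => P01; right; split; apply: contra_eq_neq P2 => PE.
  by apply: allN0 => //; apply: root0; move: P01; rewrite PE z0 add0r.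
by apply: allN0 => //; apply: root0; move: P01; rewrite PE z0 addr0.
Qed.

End AtPoint.

(** * Differentials as multiples of [d x], and the holomorphic ones *)

Section Differentials.

Variables (Omega : lmodType L) (d : L -> Omega).
Hypothesis dOmega : is_differentials iota d.
Hypothesis n_neq0 : n%:R != 0 :> L.

Variables (D : L -> L^o) (phi : {linear Omega -> L^o}).
Hypotheses (derD : derivation iota D) (Dx : D x = 1) (Dy : D y = - (x / y) ^+ n.-1).
Hypothesis phi_d : forall f, phi (d f) = D f.

Let derd : derivation iota d := dOmega.1.

Lemma d_y : d y = - (x / y) ^+ n.-1 *: d x.
Proof.
have := congr1 d (fermat_eq Lff).
rewrite (der0 derd) !(derivD derd) (der1 derd) addr0 !(der_exp derd).
rewrite -!scalerA -scalerDr => /eqP; rewrite scaler_eq0 (negPf n_neq0) /=.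
rewrite addrC addr_eq0 => /eqP Ey.
apply: (scalerI (expf_neq0 n.-1 y0)); rewrite Ey scalerA -scaleNr; congr (_ *: _).
by rewrite expr_div_n; field; rewrite expf_neq0.
Qed.

(** The difference of the two sides is a derivation that kills x, y and 1, which generate [L]. *)
Lemma d_eq f : d f = D f *: d x.
Proof.
pose E f := d f - D f *: d x.
have derE : derivation iota E.
  split=> [a b|a b|c]; rewrite /E.
  - by rewrite (derivD derd) (derivD derD) scalerDl opprD addrACA.
  - rewrite (derivM derd) (derivM derD) !scalerBr !scalerA scalerDl opprD addrACA.
    by [].
  - by rewrite (der_const derd) (der_const derD) scale0r subr0.
have Exyz i : E (xyz i) = 0.
  case: (ord3E i) => ->; rewrite tnth3E /E.
  - by rewrite Dx scale1r subrr.
  - by rewrite Dy d_y subrr.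
  - by rewrite (der1 derd) (der1 derD) scale0r subr0.
have [m [G [H [_ _ H0 ->]]]] := Lff.2 f.
by apply/eqP; rewrite -subr_eq0; apply/eqP/(der_div_eq0 derE H0); exact: der_mmap_eq0.
Qed.

(** The right side is linear in [w] and fixes every [d f], as the identity does; uniqueness in the
    universal property identifies them. *)
Lemma diff_eq w : w = phi w *: d x.
Proof.
have [psi [_ psiU]] := dOmega.2 Omega d derd.
pose chi w := phi w *: d x.
have chi_lin : linear chi.
  by move=> c u v; rewrite /chi linearP scalerDl scalerA.
pose chiL := HB.pack_for {linear Omega -> Omega} chi
  (GRing.isLinear.Build L Omega Omega *:%R chi chi_lin).
have chi_d f : chiL (d f) = d f by rewrite /= /chi phi_d [RHS]d_eq.
rewrite -[RHS]/(chiL w) (psiU _ chi_d).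
by have := psiU idfun (fun f => erefl) w.
Qed.

Lemma phi_scale a w : phi (a *: w) = a * phi w.
Proof. by rewrite linearZ. Qed.

(* In the chart where P k != 0, the derivation xyz k ^ (3 - n) y^(n-1) d/dx maps
   the affine coordinates to 0 and to (n-1)-st powers of them, up to sign. *)
Lemma regular_local P w : on_curve F P -> regular_at iota d x y P w ->
  exists2 k, P k != 0 &
    local_ring iota x y P (xyz k ^+ 3 / xyz k ^+ n * y ^+ n.-1 * phi w).
Proof.
move=> cP [m [f [g [lfg ->]]]].
pose E k z : L^o := xyz k ^+ 3 / xyz k ^+ n * y ^+ n.-1 * D z.
have derE k : derivation iota (E k).
  split=> [a b|a b|c]; rewrite /E.
  - by rewrite (derivD derD) mulrDr.
  - by rewrite (derivM derD) /GRing.scale /=; ring.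
  - by rewrite (der_const derD) mulr0.
suff [k Pk lE] : exists2 k, P k != 0 &
    forall i, local_ring iota x y P (E k (xyz i / xyz k)).
  exists k => //; rewrite linear_sum mulr_sumr; apply: (local_ring_sum cP) => i.
  have [lf lg] := lfg i.
  rewrite phi_scale phi_d mulrCA; apply: local_ringM => //.
  exact: (local_ring_derivation cP (derE k) Pk (lE)).
have lr0 : local_ring iota x y P 0 by rewrite -(rmorph0 iota); apply: local_ring_const.
have [[P2 _]|[P0 _]] := curve_chart cP.
  exists (inord 2) => // i.
  have lc j := local_ring_coord j P2; move: (lc (inord 0)) (lc (inord 1)).
  rewrite !tnth3E !divr1 => lx ly.
  rewrite /E tnth3E !expr1n !divr1 mul1r.
  case: (ord3E i) => ->; rewrite !tnth3E.
  - by rewrite Dx mulr1; apply: local_ringX.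
  - rewrite Dy.
    have -> : y ^+ n.-1 * - (x / y) ^+ n.-1 = - x ^+ n.-1.
      by rewrite expr_div_n; field; rewrite expf_neq0.
    by apply: local_ringN; apply: local_ringX.
  - by rewrite (der1 derD) mulr0.
exists (inord 0) => // i.
have lc j := local_ring_coord j P0; move: (lc (inord 1)) (lc (inord 2)).
rewrite !tnth3E => lv lu; rewrite /E tnth3E.
have xn : x ^+ n = x * x ^+ n.-1 by rewrite -exprS prednK.
have yn : y ^+ n = y * y ^+ n.-1 by rewrite -exprS prednK.
have xn0 : x ^+ n.-1 != 0 by rewrite expf_neq0.
have yn0 : y ^+ n.-1 != 0 by rewrite expf_neq0.
case: (ord3E i) => ->; rewrite !tnth3E.
- by rewrite divff // (der1 derD) mulr0.
- have -> : x ^+ 3 / x ^+ n * y ^+ n.-1 * D (y / x) = (1 / x) ^+ n.-1.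
    rewrite (der_div derD) // Dx Dy !expr_div_n expr1n xn.
    (* The numerator is [- (x ^+ n + y ^+ n)], which equals 1 on the curve. *)
    transitivity (- (x * x ^+ n.-1 + y * y ^+ n.-1) / x ^+ n.-1).
      by field; rewrite x0 xn0.
    rewrite -xn -yn; congr (_ / _).
    by apply/eqP; rewrite eqr_oppLR -addr_eq0; apply/eqP; exact: (fermat_eq Lff).
  exact: local_ringX.
- have -> : x ^+ 3 / x ^+ n * y ^+ n.-1 * D (1 / x) = - (y / x) ^+ n.-1.
    rewrite (der_div derD) // Dx (der1 derD) expr_div_n xn.
    by field; rewrite x0 xn0.
  by apply: local_ringN; apply: local_ringX.
Qed.

Lemma holomorphic_form w : holomorphic iota d F x y w ->
  w = 0 \/ exists m G,
    [/\ G \is m.-homog, (m + 3 = n)%N & w = (val G / y ^+ n.-1) *: d x].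
Proof.
move=> hw; pose f := y ^+ n.-1 * phi w.
have fE : phi w = f / y ^+ n.-1 by rewrite /f; field; rewrite expf_neq0.
case: (global_sections n_gt0 Lff (f := f)) => [P cP|f0|[m [G [homG mn fG]]]].
- have [k Pk [m [G [H [homG homH HP lE]]]]] := regular_local cP (hw P cP).
  (* Undoing the twist by the [k]-th coordinate writes [f] locally as a fraction of degree n - 3. *)
  exists (m + 3)%N, (m + n)%N, (H * 'X_k ^+ 3), (G * 'X_k ^+ n).
  rewrite !dhomogM ?homogXn //; split=> //.
  + by rewrite mevalM rmorphXn /= mevalXU mulf_neq0 // expf_neq0.
  + by rewrite addnAC.
  rewrite !rmorphM !rmorphXn /= !val_var.
  have k0 : xyz k != 0 by rewrite -val_var (val_neq0 Lff (homogX _ _) cP.2) // mevalXU.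
  have H0 := val_neq0 Lff homH cP.2 HP.
  have -> : val G = (val G / val H) * val H by rewrite divfK.
  by rewrite -lE /f; field; rewrite expf_neq0.
- by left; rewrite (diff_eq w) fE f0 mul0r scale0r.
by right; exists m, G; split=> //; rewrite {1}(diff_eq w) fE fG.
Qed.

Lemma regular_scale P f g : local_ring iota x y P f -> local_ring iota x y P g ->
  regular_at iota d x y P ((f * D g) *: d x).
Proof.
move=> lf lg; exists 1%N, (fun=> f), (fun=> g); split=> //.
by rewrite big_ord1 [d g]d_eq scalerA.
Qed.

(** In the three cases of [curve_chart] the differential is a regular function times [d y], [d x] or
    [d (1 / x)]. The bound on [i + j] keeps the exponent of [1 / x] nonnegative in the last case. *)
Lemma holomorphic_monomial i j : (i + j + 3 <= n)%N ->
  holomorphic iota d F x y ((x ^+ i * y ^+ j / y ^+ n.-1) *: d x).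
Proof.
move=> ijn P cP.
have xn0 k : x ^+ k != 0 by rewrite expf_neq0.
have yn0 k : y ^+ k != 0 by rewrite expf_neq0.
have [[P2 [P0|P1]]|[P0 P1]] := curve_chart cP.
- have -> : x ^+ i * y ^+ j / y ^+ n.-1 = - (x ^+ i * y ^+ j * (1 / x) ^+ n.-1) * D y.
    by rewrite Dy !expr_div_n expr1n; field; rewrite xn0 yn0.
  have lc k := local_ring_coord k P2; move: (lc (inord 0)) (lc (inord 1)).
  have := local_ring_coord (inord 2) P0; rewrite !tnth3E !divr1 => lx1 lx ly.
  apply: regular_scale => //; apply: local_ringN.
  by apply: local_ringM; first apply: local_ringM; apply: local_ringX.
- have -> : x ^+ i * y ^+ j / y ^+ n.-1 = (x ^+ i * y ^+ j * (1 / y) ^+ n.-1) * D x.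
    by rewrite Dx !expr_div_n expr1n; field; rewrite yn0.
  have lc k := local_ring_coord k P2; move: (lc (inord 0)) (lc (inord 1)).
  have := local_ring_coord (inord 2) P1; rewrite !tnth3E !divr1 => ly1 lx ly.
  apply: regular_scale => //.
  by apply: local_ringM; first apply: local_ringM; apply: local_ringX.
have -> : x ^+ i * y ^+ j / y ^+ n.-1 =
    - ((1 / x) ^+ (n - (i + j + 3)) * (y / x) ^+ j * (x / y) ^+ n.-1) * D (1 / x).
  rewrite (der_div derD) // Dx (der1 derD) !expr_div_n !expr1n.
  have -> : x ^+ n.-1 = x ^+ (n - (i + j + 3)) * x ^+ i * x ^+ j * x ^+ 2.
    rewrite -!exprD; congr (_ ^+ _); lia.
  by field; rewrite !xn0 yn0 x0.
have := local_ring_coord (inord 2) P0; have := local_ring_coord (inord 1) P0.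
have := local_ring_coord (inord 0) P1; rewrite !tnth3E => l1 l2 l3.
apply: regular_scale => //; apply: local_ringN.
by apply: local_ringM; first apply: local_ringM; apply: local_ringX.
Qed.

End Differentials.

End Local.

(** * Exact differentials and the Cartier operator *)

Section Exactness.

Variables (K L : fieldType) (iota : {rmorphism K -> L}) (D : L -> L^o).
Hypothesis derD : derivation iota D.
Variables (x : L) (p : nat).
Hypotheses (charL : p \in [pchar L]) (Dx : D x = 1).

Let p_prime : prime p := pcharf_prime charL.
Let p_gt0 : (0 < p)%N := prime_gt0 p_prime.

Lemma natr_neq0 k : (0 < k < p)%N -> k%:R != 0 :> L.
Proof. by case/andP=> k0 kp; rewrite -(dvdn_pcharf charL) gtnNdvd. Qed.

Lemma natr_fact_neq0 k : (k < p)%N -> k`!%:R != 0 :> L.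
Proof.
elim: k => [|k IH] kp; first by rewrite oner_eq0.
by rewrite factS natrM; apply: mulf_neq0; [exact: natr_neq0 | exact/IH/ltnW].
Qed.

Lemma natr_shift_neq0 i j : (i < p)%N -> (j < p)%N -> i != j -> (i + p - j)%:R != 0 :> L.
Proof.
move=> ip jp ij; have [lij|lji] := ltnP i j; first by rewrite natr_neq0; lia.
have -> : (i + p - j = (i - j) + p)%N by lia.
by rewrite natrD (pcharf0 charL) addr0 natr_neq0; lia.
Qed.

Lemma natr_expp k : k%:R ^+ p = k%:R :> L.
Proof. exact: (pFrobenius_aut_nat charL). Qed.

Lemma expp_add a b : (a + b) ^+ p = a ^+ p + b ^+ p :> L.
Proof. exact: (rmorphD (pFrobenius_aut charL)). Qed.

Lemma expp_sum I (r : seq I) (P : pred I) (f : I -> L) :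
  (\sum_(i <- r | P i) f i) ^+ p = \sum_(i <- r | P i) f i ^+ p.
Proof. exact: (rmorph_sum (pFrobenius_aut charL)). Qed.

Lemma expp_opp a : (- a) ^+ p = - a ^+ p :> L.
Proof. exact: (pFrobenius_autN charL). Qed.

Lemma der_expp z : D (z ^+ p) = 0.
Proof. by rewrite (der_exp derD) (pcharf0 charL) mul0r scale0r. Qed.

Lemma der_expp_mul z f : D (z ^+ p * f) = z ^+ p * D f.
Proof. by rewrite (derivM derD) der_expp scaler0 addr0. Qed.

Lemma der_xn k : D (x ^+ k) = k%:R * x ^+ k.-1.
Proof. by rewrite (der_exp derD) Dx /GRing.scale /= mulr1. Qed.

Definition is_exact f := exists g, f = D g.

Lemma exactD f g : is_exact f -> is_exact g -> is_exact (f + g).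
Proof. by move=> [a ->] [b ->]; exists (a + b); rewrite (derivD derD). Qed.

Lemma exact0 : is_exact 0.
Proof. by exists 0; rewrite (der0 derD). Qed.

Lemma exact_expp z f : is_exact f -> is_exact (z ^+ p * f).
Proof. by move=> [g ->]; exists (z ^+ p * g); rewrite der_expp_mul. Qed.

Lemma exactN f : is_exact f -> is_exact (- f).
Proof.
by move=> /(exact_expp (- 1)); rewrite expp_opp expr1n mulN1r.
Qed.

Lemma exact_sum I (r : seq I) (P : pred I) (f : I -> L) :
  (forall i, P i -> is_exact (f i)) -> is_exact (\sum_(i <- r | P i) f i).
Proof. by move=> ef; apply: (big_ind is_exact) => //; [exact: exact0 | exact: exactD]. Qed.

Lemma exact_pow_der t k : k.+1%:R != 0 :> L -> is_exact (t ^+ k * D t).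
Proof.
(* The factor 1/(k + 1) is its own p-th power, so [D] is linear over it. *)
move=> k0; exists ((k.+1%:R)^-1 ^+ p * t ^+ k.+1); rewrite der_expp_mul.
rewrite (der_exp derD) exprVn natr_expp /GRing.scale /=; field.
by rewrite addrC natr1.
Qed.

Lemma exact_xn k : k.+1%:R != 0 :> L -> is_exact (x ^+ k).
Proof. by move=> /(exact_pow_der x); rewrite Dx mulr1. Qed.

(** The span of 1, x, ..., x^(p-1) over the p-th powers; the next lemmas show that it is a
    subfield. *)
Definition pbasis z := exists u : nat -> L, z = \sum_(i < p) u i ^+ p * x ^+ i.

Lemma pbasisD a b : pbasis a -> pbasis b -> pbasis (a + b).
Proof.
move=> [u ->] [v ->]; exists (fun i => u i + v i); rewrite -big_split.
by apply: eq_bigr => i _; rewrite expp_add mulrDl.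
Qed.

Lemma pbasis_expp z a : pbasis a -> pbasis (z ^+ p * a).
Proof.
move=> [u ->]; exists (fun i => z * u i); rewrite mulr_sumr.
by apply: eq_bigr => i _; rewrite exprMn mulrA.
Qed.

Lemma pbasis_xn k : pbasis (x ^+ k).
Proof.
rewrite (divn_eq k p) exprD exprM; apply: pbasis_expp.
exists (fun i => (i == k %% p)%N%:R).
have ltk : (k %% p < p)%N by rewrite ltn_mod.
rewrite (bigD1 (Ordinal ltk)) //= eqxx expr1n mul1r big1 ?addr0 // => i.
by rewrite -val_eqE /= => /negPf ->; rewrite expr0n gtn_eqF // mul0r.
Qed.

Lemma pbasis0 : pbasis 0.
Proof.
by exists (fun=> 0); rewrite big1 // => i _; rewrite expr0n gtn_eqF // mul0r.
Qed.

Lemma pbasis_pow z : pbasis (z ^+ p).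
Proof. by rewrite -[_ ^+ p]mulr1; apply: pbasis_expp; apply: (pbasis_xn 0). Qed.

Lemma pbasisM a b : pbasis a -> pbasis b -> pbasis (a * b).
Proof.
move=> [u ->] [v ->]; rewrite mulr_suml.
apply: (big_ind pbasis) => [||i _]; [exact: pbasis0 | exact: pbasisD |].
rewrite mulr_sumr; apply: (big_ind pbasis) => [||j _]; [exact: pbasis0 | exact: pbasisD |].
by rewrite mulrACA -exprMn -exprD; apply: pbasis_expp; apply: pbasis_xn.
Qed.

Lemma pbasisX a k : pbasis a -> pbasis (a ^+ k).
Proof.
move=> ba; elim: k => [|k IH]; first exact: (pbasis_xn 0).
by rewrite exprS; apply: pbasisM.
Qed.

Lemma pbasisV a : pbasis a -> pbasis a^-1.
Proof.
move=> ba; have [->|a0] := eqVneq a 0; first by rewrite invr0; apply: pbasis0.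
have -> : a^-1 = a^-1 ^+ p * a ^+ p.-1.
  by rewrite exprVn -{1}(prednK p_gt0) exprS; field; rewrite a0 expf_neq0.
by apply: pbasis_expp; apply: pbasisX.
Qed.

Hypothesis pbasisL : forall z, pbasis z.

Lemma iter_der_expp k z f : iter k D (z ^+ p * f) = z ^+ p * iter k D f.
Proof. by elim: k => //= k ->; rewrite der_expp_mul. Qed.

Lemma iter_der_xn k m : iter k D (x ^+ m) = (m ^_ k)%:R * x ^+ (m - k).
Proof.
elim: k => [|k IH]; first by rewrite ffactn0 mul1r subn0.
rewrite /= IH -{1}natr_expp der_expp_mul der_xn natr_expp mulrA -natrM -ffactnSr.
by rewrite subnS.
Qed.

(** The p-th iterate is linear over p-th powers and kills x^i for i < p. *)
Lemma iter_der_p z : iter p D z = 0.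
Proof.
have iterD k a b : iter k D (a + b) = iter k D a + iter k D b.
  by elim: k => //= k ->; rewrite (derivD derD).
have iter0 k : iter k D 0 = 0 by elim: k => //= k ->; rewrite (der0 derD).
have [u ->] := pbasisL z.
rewrite (big_morph (iter p D) (iterD p) (iter0 p)) big1 // => i _.
by rewrite iter_der_expp iter_der_xn ffact_small // mul0r mulr0.
Qed.

(** Applying [D] another p - 1 times gives [z ^+ p] times (p - 1)! on one side and a p-th iterate,
    hence 0, on the other. *)
Lemma exact_top z : is_exact (z ^+ p * x ^+ p.-1) -> z = 0.
Proof.
move=> [g gE]; have := iter_der_p g.
rewrite -(prednK p_gt0) iterSr -gE iter_der_expp iter_der_xn ffactnn subnn mulr1.
move/eqP; rewrite mulf_eq0 expf_eq0 p_gt0 /= => /orP[/eqP // |].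
by rewrite (negPf (natr_fact_neq0 _)) // prednK.
Qed.

(** Multiplying [D t] by x^(p-k) moves the [k]-th term of the expansion to x^(p-1) and makes all
    others exact, so [exact_top] gives [v k = 0] for 0 < k < p. *)
Lemma der_eq0 t : D t = 0 -> exists u, t = u ^+ p.
Proof.
have [v tE] := pbasisL t; move=> Dt0; exists (v 0%N).
suff v0 k : (0 < k < p)%N -> v k = 0.
  rewrite tE; case: (p) p_gt0 v0 => // q _ v0.
  rewrite big_ord_recl big1 ?addr0 ?mulr1 // => i _.
  by rewrite v0 ?expr0n ?mul0r //= ltnS.
move=> /andP[k0 kp].
have : is_exact (D t * x ^+ (p - k)) by rewrite Dt0 mul0r; apply: exact0.
have -> : D t = \sum_(i < p) v i ^+ p * (i%:R * x ^+ i.-1).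
  by rewrite {1}tE (der_sum derD); apply: eq_bigr => i _; rewrite der_expp_mul der_xn.
rewrite (bigD1 (Ordinal kp)) //= mulrDl.
set rest := (X in _ + X); move=> ex_sum.
have ex_rest : is_exact rest.
  rewrite /rest mulr_suml; apply: exact_sum => i ik.
  rewrite -mulrA; apply: exact_expp.
  case: (posnP i) => [->|i0]; first by rewrite mulr0n !mul0r; apply: exact0.
  rewrite -mulrA -exprD -natr_expp; apply/exact_expp/exact_xn.
  have -> : (i.-1 + (p - k)).+1 = (i + p - k)%N by lia.
  exact: natr_shift_neq0.
have : is_exact ((v k * k%:R) ^+ p * x ^+ p.-1).
  have := exactD ex_sum (exactN ex_rest); rewrite addrK exprMn natr_expp.
  rewrite -!mulrA -exprD.
  by have -> : (k.-1 + (p - k) = p.-1)%N by lia.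
move=> /exact_top/eqP; rewrite mulf_eq0 (negPf (natr_neq0 _)) ?k0 // orbF.
by move/eqP.
Qed.

Variables (Omega : lmodType L) (d : L -> Omega) (phi : {linear Omega -> L^o}).
Hypotheses (derd : derivation iota d) (phi_d : forall f, phi (d f) = D f).
Hypothesis diffE : forall w, w = phi w *: d x.

(** For a separating [t], [D t] is nonzero, so the top coefficient vanishes, and the terms below it
    integrate. Conversely, the derivative of an expansion in powers of x has no term in x^(p-1). *)
Lemma cartier0_exact w : cartier d p w 0 <-> is_exact (phi w).
Proof.
split=> [[t [u [j [sep jE -> /esym uj0]]]]|[g gE]].
  have Dt0 : D t != 0 by apply: contra_notN sep => /eqP/der_eq0.
  have {}uj0 : u j = 0.
    have /eqP := congr1 phi uj0; rewrite linearZ linear0 /= phi_d.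
    by rewrite mulf_eq0 (negPf Dt0) orbF => /eqP.
  rewrite linearZ /= phi_d /GRing.scale /= mulr_suml; apply: exact_sum => i _.
  rewrite -mulrA; have [->|ij] := eqVneq i j.
    by rewrite uj0 expr0n gtn_eqF // mul0r; apply: exact0.
  apply/exact_expp/exact_pow_der/natr_neq0; rewrite /= ltn_neqAle ltn_ord andbT.
  by apply: contraNneq ij => ip; apply/eqP/val_inj => /=; rewrite jE -(congr1 predn ip).
have [v vE] := pbasisL g; have ltp : (p.-1 < p)%N by rewrite prednK.
(* These are the coefficients of [D g]: the factor i + 1 from the derivative equals its p-th power,
   and the top coefficient is 0. *)
exists x, (fun i : 'I_p => if (i.+1 < p)%N then i.+1%:R * v i.+1 else 0), (Ordinal ltp).
split=> //=.
- case=> u xE; have := der_expp u; rewrite -xE Dx => /eqP.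
  by rewrite oner_eq0.
- rewrite (diffE w) gE vE (der_sum derD); congr (_ *: _).
  rewrite (eq_bigr (fun i : 'I_p => v i ^+ p * (i%:R * x ^+ i.-1))); last first.
    by move=> i _; rewrite der_expp_mul der_xn.
  have := natr_expp; rewrite -(prednK p_gt0) => natrE.
  rewrite big_ord_recl big_ord_recr /= mulr0n mul0r mulr0 add0r ltnn.
  rewrite expr0n mul0r addr0; apply: eq_bigr => i _.
  rewrite ltnS ltn_ord exprMn natrE.
  by rewrite /bump add1n add0n mulrCA mulrA.
by rewrite prednK // ltnn scale0r.
Qed.

End Exactness.

Lemma closed_horner_eq0 (K : closedFieldType) (q : {poly K}) :
  (forall a, q.[a] = 0) -> q = 0.
Proof.
move=> q0; apply/eqP; apply: contraT => qN0.
(* At a root of [q * 'X + 1] the polynomial [q] cannot vanish. *)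
have /closed_rootP[a] : size (q * 'X + 1) != 1%N.
  by rewrite -[1]/(1%:P) size_MXaddC (negPf qN0) /= eqSS size_poly_eq0.
by rewrite rootE hornerMXaddC q0 mul0r add0r oner_eq0.
Qed.

(** * Monomial differentials *)

(* The Cartier operator sends x^(a-1) y^(b-1) w0 to a multiple of
   x^(a'-1) y^(b'-1) w0, with a' and b' the images of a and b. *)
Definition swap_digits (p s b : nat) : nat := (b %/ p + s * (b %% p))%N.

Lemma swap_digits_gt0 p s b : (0 < s)%N -> (0 < b)%N -> (0 < swap_digits p s b)%N.
Proof.
move=> s0 b0; rewrite lt0n addn_eq0 muln_eq0 (gtn_eqF s0) /=.
apply: contraTN b0 => /andP[/eqP q0 /eqP r0].
by rewrite (divn_eq b p) q0 r0.
Qed.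

Lemma swap_digits_lt p s b : (b < s * p)%N -> (swap_digits p s b < s * p)%N.
Proof.
move=> bsp; have p0 : (0 < p)%N by case: p bsp => //; rewrite muln0.
have : (b %/ p < s)%N by rewrite ltn_divLR.
rewrite -(ltn_add2r (s * (b %% p))) => /leq_trans; apply.
by rewrite -mulnS leq_mul2l ltn_mod p0 orbT.
Qed.

(** As [b %/ p < s], division of the image by [s] returns [b %% p] as quotient and [b %/ p] as
    remainder. *)
Lemma swap_digits_inj p s b c : (b < s * p)%N -> (c < s * p)%N ->
  swap_digits p s b = swap_digits p s c -> b = c.
Proof.
move=> bsp csp; have p0 : (0 < p)%N by case: p bsp {csp} => //; rewrite muln0.
have [bs cs] : (b %/ p < s)%N /\ (c %/ p < s)%N by rewrite !ltn_divLR.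
rewrite /swap_digits => E; have s0 : (0 < s)%N by apply: leq_trans bs.
have Er := congr1 (divn^~ s) E; have Eq := congr1 (modn^~ s) E.
move: Er Eq => /=; rewrite ![(_ + s * _)%N]addnC ![(s * _)%N]mulnC !divnMDl //.
rewrite !modnMDl (divn_small bs) (divn_small cs) (modn_small bs) (modn_small cs).
rewrite !addn0 => Er Eq.
by rewrite (divn_eq b p) Er Eq -divn_eq.
Qed.

Section Monomials.

Variables (K : closedFieldType) (n : nat) (n_gt0 : (0 < n)%N).
Variables (L : fieldType) (iota : {rmorphism K -> L}) (x y : L).
Hypothesis Lff : is_function_field iota x y (fermat_form K n).

Local Notation F := (fermat_form K n).
Local Notation val := (generic_val iota x y).
Local Notation X0 := ('X_(inord 0) : {mpoly K[3]}).
Local Notation X1 := ('X_(inord 1) : {mpoly K[3]}).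
Local Notation X2 := ('X_(inord 2) : {mpoly K[3]}).

Let x0 : x != 0 := x_neq0 n_gt0 Lff.
Let y0 : y != 0 := y_neq0 n_gt0 Lff.

(** A homogenized relation is a multiple of [F]. On each line x = a its degree in Y is below n, so
    it vanishes there; each coefficient of a power of Y is then a polynomial in [a] without nonzero
    values. *)
Lemma monomials_free (I : finType) (Q : pred I) (A B : I -> nat) (c : I -> K) :
  {in Q &, injective (fun i => (A i, B i))} -> (forall i, Q i -> (B i < n)%N) ->
  \sum_(i | Q i) iota (c i) * (x ^+ A i * y ^+ B i) = 0 -> forall i, Q i -> c i = 0.
Proof.
move=> injAB ltB sum0 i0 Qi0.
pose m := (\sum_i (A i + B i))%N.
have lem i : (A i + B i <= m)%N by rewrite /m (bigD1 i) ?leq_addr.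
pose G := \sum_(i | Q i) (c i)%:MP * (X0 ^+ A i * X1 ^+ B i * X2 ^+ (m - (A i + B i))).
have homG : G \is m.-homog.
  apply: rpred_sum => i _; rewrite mul_mpolyC rpredZ //.
  by rewrite -{2}(subnKC (lem i)) !dhomogM ?homogXn.
have valG : val G = 0.
  rewrite -sum0 rmorph_sum; apply: eq_bigr => i _ /=.
  by rewrite !rmorphM !rmorphXn /= valC !valX expr1n mulr1.
have [R GE] := (Lff.1 _ _ homG).1 valG.
have restrG a : restr a 1 G = \sum_(i | Q i) (c i * a ^+ A i) *: 'X^(B i).
  rewrite rmorph_sum; apply: eq_bigr => i _ /=.
  rewrite !rmorphM !rmorphXn /= restrC !restrX -mul_polyC expr1n rmorphM rmorphXn /=; ring.
have restrG0 a : restr a 1 G = 0.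
  apply/eqP; apply: contraT => rG0; have : restr a 1 F %| restr a 1 G.
    by rewrite GE rmorphM dvdp_mulIr.
  rewrite restr_fermat => /(dvdp_leq rG0); rewrite size_XnaddC // restrG leqNgt ltnS.
  rewrite (leq_trans (size_sum _ _ _)) //; apply/bigmax_leqP => i Qi.
  by rewrite (leq_trans (size_scale_leq _ _)) // size_polyXn ltB.
pose q := \sum_(i | Q i && (B i == B i0)) c i *: 'X^(A i).
have q0 : q = 0.
  apply: closed_horner_eq0 => a.
  have := congr1 (fun r : {poly K} => r`_(B i0)) (restrG0 a).
  rewrite restrG coef0 coef_sum => <-; rewrite horner_sum big_mkcondr /=.
  apply: eq_bigr => i _; rewrite coefZ coefXn eq_sym.
  by case: eqP => _; rewrite ?mulr0 // hornerZ hornerXn mulr1.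
have := congr1 (fun r : {poly K} => r`_(A i0)) q0.
rewrite coef0 coef_sum (bigD1 i0) ?Qi0 ?eqxx //= coefZ coefXn eqxx mulr1.
rewrite big1 ?addr0 // => i /andP[/andP[Qi /eqP BE] ii0].
rewrite coefZ coefXn; case: eqP => [AE|_]; last by rewrite mulr0.
by case/eqP: ii0; apply: injAB => //; rewrite BE AE.
Qed.

Variables (p s : nat).
Hypotheses (charL : p \in [pchar L]) (nE : n.+1 = (s * p)%N).

Let p_prime : prime p := pcharf_prime charL.
Let p_gt0 : (0 < p)%N := prime_gt0 p_prime.

Lemma root_p c : exists e : K, c = e ^+ p.
Proof.
have /closed_rootP[e] : size ('X^p - c%:P) != 1%N by rewrite size_XnsubC // eqSS -lt0n.
by rewrite rootE !hornerE subr_eq0 => /eqP <-; exists e.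
Qed.

Lemma yn_eq : y ^+ n = - (1 + x ^+ n).
Proof. by apply/eqP; rewrite -addr_eq0 -(fermat_eq Lff); apply/eqP; ring. Qed.

(** Constants are p-th powers since [K] is algebraically closed, and [n.+1 = s * p] gives
    [y = (y ^+ s) ^+ p / y ^+ n] with [y ^+ n] a polynomial in x. *)
Lemma fermat_pbasis z : pbasis x p z.
Proof.
have basisC c : pbasis x p (iota c).
  by have [e ->] := root_p c; rewrite rmorphXn; apply: (pbasis_pow _ charL).
have basisx : pbasis x p x by exact: (pbasis_xn _ charL 1).
have basisy : pbasis x p y.
  have -> : y = (y ^+ s) ^+ p * (y ^+ n)^-1.
    by rewrite -exprM -nE exprS mulfK // expf_neq0.
  rewrite yn_eq; apply: (pbasisM charL); first exact: (pbasis_pow _ charL).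
  apply: (pbasisV charL); rewrite -mulN1r -(rmorphN1 iota).
  apply: (pbasisM charL) => //; rewrite -(rmorph1 iota).
  by apply: (pbasisD charL) => //; apply: (pbasisX charL).
have basisval G : pbasis x p (val G).
  elim/mpoly_alg_ind: G => [c|i|G H bG bH|G H bG bH].
  - by rewrite valC.
  - by case: (ord3E i) => ->; rewrite valX // -(rmorph1 iota).
  - by rewrite rmorphD; apply: (pbasisD charL).
  - by rewrite rmorphM; apply: (pbasisM charL).
have [m [G [H [_ _ _ ->]]]] := Lff.2 z.
by apply: (pbasisM charL) => //; apply: (pbasisV charL).
Qed.

Variable D : L -> L^o.
Hypotheses (derD : derivation iota D) (Dx : D x = 1).

(** The monomial W whose p-th power splits off. The exponent of y is [swap_digits p s b], and the
    denominator equals [- (x + (x ^+ s) ^+ p)]. *)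
Definition monomial_factor (a b : nat) : L :=
  x ^+ (a %/ p)%N * y ^+ (b %/ p + s * (b %% p))%N / (x * y ^+ n).

(** With q = x y^n, the left side is x^a y^b / q. Since (b/p + s b0) p = b + n b0, where b/p is the
    integer quotient, y^b is a p-th power times x^b0 / q^b0; finally 1 / q^(b0+1) = q^(p-1-b0) /
    q^p. *)
Lemma monomial_split i j :
  x ^+ i * y ^+ j / y ^+ n.-1 = monomial_factor i.+1 j.+1 ^+ p *
    (x ^+ (i.+1 %% p + j.+1 %% p)%N * (- (x + (x ^+ s) ^+ p)) ^+ (p.-1 - j.+1 %% p)).
Proof.
set a := i.+1; set b := j.+1; set a0 := (a %% p)%N; set b0 := (b %% p)%N.
have b0p : (b0 < p)%N by rewrite ltn_mod.
have -> : - (x + (x ^+ s) ^+ p) = x * y ^+ n.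
  by rewrite yn_eq -exprM -nE exprS; ring.
rewrite /monomial_factor -/b0 expr_div_n; set q := x * y ^+ n.
have q0 : q != 0 by rewrite mulf_neq0 // expf_neq0.
have qE : q ^+ p = q ^+ (p.-1 - b0) * q ^+ b0 * q.
  by rewrite -exprD -exprSr; congr (_ ^+ _); lia.
have -> : x ^+ i * y ^+ j / y ^+ n.-1 = x ^+ a * y ^+ b / q.
  rewrite /a /b /q -{2}(prednK n_gt0) !exprS; field.
  by rewrite x0 y0 expf_neq0.
have xa : x ^+ a = (x ^+ (a %/ p)%N) ^+ p * x ^+ a0.
  by rewrite -exprM -exprD -divn_eq.
have yb : (y ^+ (b %/ p + s * b0)%N) ^+ p * x ^+ b0 = y ^+ b * q ^+ b0.
  have yE : ((b %/ p + s * b0) * p = b + n * b0)%N.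
    rewrite mulnDl mulnAC -nE mulSn addnA; congr (_ + _)%N.
    by rewrite {2}(divn_eq b p).
  by rewrite /q -exprM yE exprMn exprD exprM; ring.
rewrite exprMn qE xa (exprD x a0).
have -> : y ^+ b = (y ^+ (b %/ p + s * b0)%N) ^+ p * x ^+ b0 / q ^+ b0.
  by rewrite yb mulfK // expf_neq0.
by field; rewrite q0 !expf_neq0.
Qed.

(** The [l]-th binomial term is a p-th power times x^(a+p-1-l), which is exact unless [l = a]. *)
Lemma exact_binomial a b z : (a < p)%N -> (b < p)%N ->
  is_exact D (x ^+ (a + b)%N * (- (x + z ^+ p)) ^+ (p.-1 - b) -
    ((-1) ^+ (p.-1 - b) * 'C(p.-1 - b, a)%:R * z ^+ a) ^+ p * x ^+ p.-1).
Proof.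
move=> ap bp; set h := (p.-1 - b)%N.
pose T l := ((-1) ^+ h * 'C(h, l)%:R * z ^+ l) ^+ p * x ^+ (a + p.-1 - l).
have sgnE : ((-1) ^+ h) ^+ p = (-1) ^+ h :> L.
  by rewrite exprAC (expp_opp charL) expr1n.
have -> : x ^+ (a + b)%N * (- (x + z ^+ p)) ^+ h = \sum_(l < h.+1) T l.
  rewrite exprNn exprDn !mulr_sumr; apply: eq_bigr => l _.
  rewrite /T !exprMn sgnE (natr_expp charL) -mulr_natr.
  have -> : (a + p.-1 - l = a + b + (h - l))%N.
    by have := ltn_ord l; rewrite /h; lia.
  by rewrite !exprD (exprAC z p); ring.
have exT l : (l < h.+1)%N -> l != a -> is_exact D (T l).
  move=> lh la; apply: (exact_expp derD charL); apply: (exact_xn derD charL Dx).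
  have -> : (a + p.-1 - l).+1 = (a + p - l)%N by rewrite /h in lh; lia.
  by apply: (natr_shift_neq0 charL) => //; [rewrite /h in lh; lia | rewrite eq_sym].
have -> : ((-1) ^+ h * 'C(h, a)%:R * z ^+ a) ^+ p * x ^+ p.-1 = T a.
  by rewrite /T addKn.
(* If [h < a], the term [l = a] is absent from the sum and its binomial coefficient is 0. *)
have [ha|ah] := ltnP h a.
  have -> : T a = 0.
    by rewrite /T bin_small // mulr0 mul0r expr0n gtn_eqF // mul0r.
  rewrite subr0; apply: (exact_sum derD) => l _; apply: exT => //.
  by rewrite neq_ltn (leq_ltn_trans _ ha) // -ltnS.
rewrite (bigD1 (Ordinal (ah : a < h.+1)%N)) //= addrAC subrr add0r.
by apply: (exact_sum derD) => l la; apply: exT.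
Qed.

(* The constant factor of the coefficient of x^(p-1) dx in x^i y^j w0; as an
   element of the prime field, it is its own p-th power. *)
Definition residue_const i j : K :=
  (-1) ^+ (p.-1 - j.+1 %% p) * 'C(p.-1 - j.+1 %% p, i.+1 %% p)%:R.

(** Below the threshold the binomial coefficient divides the factorial of a number less than p;
    otherwise its lower index exceeds the upper one. *)
Lemma residue_const_neq0 i j :
  (residue_const i j != 0) = (i.+1 %% p + j.+1 %% p < p)%N.
Proof.
rewrite /residue_const mulf_eq0 signr_eq0 /=.
have jp : (j.+1 %% p < p)%N by rewrite ltn_mod.
case: ltnP => ltp; last by rewrite bin_small ?eqxx //; lia.
apply: contraTneq (natr_fact_neq0 charL (k := p.-1 - j.+1 %% p) _) => [C0|]; last by lia.
rewrite -(bin_fact (m := i.+1 %% p)) ?natrM; last by lia.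
by rewrite -(rmorph_nat iota) C0 rmorph0 mul0r eqxx.
Qed.

Lemma monomial_residue i j :
  is_exact D (x ^+ i * y ^+ j / y ^+ n.-1 -
    (iota (residue_const i j) * x ^+ (s * (i.+1 %% p)) * monomial_factor i.+1 j.+1) ^+ p
      * x ^+ p.-1).
Proof.
rewrite monomial_split /residue_const rmorphM rmorph_nat rmorphXn rmorphN1 /=.
rewrite exprM [(_ * monomial_factor _ _) ^+ p]exprMn.
rewrite [_ * monomial_factor _ _ ^+ p]mulrC -[X in _ - X]mulrA -mulrBr.
by apply: (exact_expp derD charL); apply: exact_binomial; rewrite ltn_mod.
Qed.

(** Modulo exact terms the sum is the p-th power of the sum of the [g i], times x^(p-1). By
    [exact_top] it is exact iff the [g i] sum to 0, and these are scalar multiples of distinct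
    monomials up to a common factor. *)
Lemma exact_monomials (I : finType) (Q : pred I) (A B : I -> nat) (c : I -> K) :
  {in Q &, injective (fun i => (A i, B i))} -> (forall i, Q i -> (A i + B i + 3 <= n)%N) ->
  is_exact D (\sum_(i | Q i) iota (c i) * (x ^+ A i * y ^+ B i / y ^+ n.-1)) <->
  (forall i, Q i -> ((A i).+1 %% p + (B i).+1 %% p < p)%N -> c i = 0).
Proof.
move=> injAB ltn.
(* Taking p-th roots of the coefficients lets them enter the p-th power. *)
have /fin_all_exists[e ce] i : exists e, c i = e ^+ p by exact: root_p.
pose g i := iota (e i * residue_const (A i) (B i)) *
  (x ^+ (s * ((A i).+1 %% p)) * monomial_factor (A i).+1 (B i).+1).
pose f := \sum_(i | Q i) iota (c i) * (x ^+ A i * y ^+ B i / y ^+ n.-1).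
have exf : is_exact D (f - (\sum_(i | Q i) g i) ^+ p * x ^+ p.-1).
  rewrite (expp_sum charL) mulr_suml -sumrB; apply: (exact_sum derD) => i _.
  have -> : g i ^+ p = iota (e i) ^+ p * (iota (residue_const (A i) (B i)) *
      x ^+ (s * ((A i).+1 %% p)) * monomial_factor (A i).+1 (B i).+1) ^+ p.
    by rewrite -exprMn /g rmorphM /=; congr (_ ^+ _); ring.
  rewrite ce rmorphXn /= -[X in _ - X]mulrA -mulrBr; apply: (exact_expp derD charL).
  exact: monomial_residue.
have -> : is_exact D f <-> \sum_(i | Q i) g i = 0.
  split=> [ex|g0]; last by move: exf; rewrite g0 expr0n gtn_eqF // mul0r subr0.
  apply: (exact_top derD charL Dx fermat_pbasis).
  have := exactD derD ex (exactN derD charL exf).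
  by rewrite opprB addrCA subrr addr0.
split=> [g0 i Qi ltp|c0]; last first.
  rewrite big1 // => i Qi; rewrite /g.
  have [/(c0 i Qi) ci|gep] := ltnP ((A i).+1 %% p + (B i).+1 %% p) p.
    move: ci; rewrite ce => /eqP; rewrite expf_eq0 => /andP[_ /eqP ->].
    by rewrite mul0r rmorph0 mul0r.
  suff -> : residue_const (A i) (B i) = 0 by rewrite mulr0 rmorph0 mul0r.
  by apply/eqP; rewrite -[_ == _]negbK residue_const_neq0 -leqNgt.
suff : e i * residue_const (A i) (B i) = 0.
  move/eqP; rewrite mulf_eq0 -[X in _ || X]negbK residue_const_neq0 ltp orbF.
  by move=> /eqP ei; rewrite ce ei expr0n gtn_eqF.
have lt_sp i0 : Q i0 -> ((A i0).+1 < s * p)%N /\ ((B i0).+1 < s * p)%N.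
  by move=> /ltn; rewrite -nE; lia.
(* Lowering the exponent of y by one brings it below n, as [monomials_free] requires; the y removed
   goes into the common factor [y / (x * y ^+ n)]. *)
pose A' i := swap_digits p s (A i).+1; pose B' i := (swap_digits p s (B i).+1).-1.
have BE i0 : (B' i0).+1 = swap_digits p s (B i0).+1.
  rewrite /B' prednK // swap_digits_gt0 //; first by move: nE; lia.
apply: (@monomials_free _ Q A' B' (fun i => e i * residue_const (A i) (B i))) => //.
- move=> i1 i2 Q1 Q2 [EA /(congr1 S)]; rewrite !BE => EB.
  have [A1 B1] := lt_sp i1 Q1; have [A2 B2] := lt_sp i2 Q2.
  by apply: injAB => //; congr (_, _); apply: succn_inj; apply: (@swap_digits_inj p s).
- move=> i1 Q1; rewrite -ltnS BE nE; apply: swap_digits_lt => //.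
  by case: (lt_sp i1 Q1).
have K0 : y / (x * y ^+ n) != 0 by rewrite !(mulf_neq0, invr_neq0, expf_neq0).
apply: (mulIf K0); rewrite mul0r mulr_suml -[RHS]g0; apply: eq_bigr => i1 Q1.
rewrite /g /monomial_factor -/(swap_digits p s (B i1).+1) -BE /A' /swap_digits exprD exprS.
by field; rewrite x0 expf_neq0.
Qed.

End Monomials.

(** * The kernel of the Cartier operator *)

Section Counting.

Local Open Scope nat_scope.

Lemma sum_ltn s k : k <= s -> \sum_(v < s) (v < k) = k.
Proof.
elim: s k => [|s IH] k; first by rewrite leqn0 big_ord0 => /eqP.
rewrite big_ord_recr /= leq_eqVlt => /orP[/eqP->|]; last first.
  by rewrite ltnS => ks; rewrite IH // ltnNge ks addn0.
rewrite ltnSn addn1; congr S; rewrite -[RHS](IH s) //.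
by apply: eq_bigr => i _; rewrite ltnS ltnW // ltn_ord.
Qed.

Lemma sum_ord_mul (F : nat -> nat) s p :
  \sum_(a < s * p) F a = \sum_(u < s) \sum_(r < p) F (u * p + r).
Proof.
elim: s => [|s IH]; first by rewrite mul0n !big_ord0.
by rewrite mulSnr big_split_ord big_ord_recr /= -IH.
Qed.

Lemma sum_rev s : \sum_(u < s) (s.-1 - u) = 'C(s, 2).
Proof.
rewrite -bin2_sum big_mkord (reindex_inj rev_ord_inj) /=.
by apply: eq_bigr => i _; have := ltn_ord i; lia.
Qed.

Lemma sum_geq p a : a < p -> \sum_(b < p) (p <= a + b) = a.
Proof.
move=> ap; have : \sum_(b < p) (p <= a + b) + \sum_(b < p) (b < p - a) = p.
  rewrite -big_split -[RHS]card_ord -sum1_card; apply: eq_bigr => b _ /=.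
  by rewrite ltn_subRL leqNgt; case: ltnP.
by rewrite sum_ltn ?leq_subr //; set S := bigop _ _ _; lia.
Qed.

Lemma kernel_count n s p : 0 < p -> n.+1 = s * p ->
  #|[set ij : 'I_n * 'I_n | (ij.1 + ij.2 + 3 <= n) &&
      (p <= ij.1.+1 %% p + ij.2.+1 %% p)]| = 'C(s, 2) * 'C(p, 2).
Proof.
move=> p0 nE; pose c a b : nat := (a + b < n) && (p <= a %% p + b %% p).
transitivity (\sum_(a < n.+1) \sum_(b < n.+1) c a b).
  (* Index 0 contributes nothing, so both ranges extend to all residues below [s * p]. *)
  have c0l b : c 0 b = 0 by rewrite /c mod0n !add0n [p <= _]leqNgt ltn_mod p0 andbF.
  have c0r a : c a 0 = 0 by rewrite /c mod0n !addn0 [p <= _]leqNgt ltn_mod p0 andbF.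
  rewrite big_ord_recl [X in X + _]big1 => [|b _]; last exact: c0l.
  under eq_bigr => a _ do rewrite big_ord_recl c0r add0n.
  rewrite add0n pair_big -sum1_card big_mkcond; apply: eq_bigr => -[i j] _.
  rewrite inE /c /= /bump /= !add1n.
  by have -> : (i.+1 + j.+1 < n) = (i + j + 3 <= n) by lia.
rewrite nE (sum_ord_mul (fun a => \sum_(b < s * p) c a b)).
(* If [p <= a + b], the total lies between (u + v + 1) p and (u + v + 2) p - 2, so it is below n = s
   p - 1 exactly when u + v + 2 <= s. *)
have cE u v (a b : 'I_p) : c (u * p + a) (v * p + b) = (v < s.-1 - u) * (p <= a + b).
  rewrite /c !modnMDl !modn_small // mulnb; congr nat_of_bool.
  have [pab|] := leqP p (a + b); last by rewrite !andbF.
  rewrite !andbT; have := ltn_ord a; have := ltn_ord b => bp ap.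
  have [vs|sv] := ltnP v (s.-1 - u).
    have : (u + v + 2) * p <= s * p by rewrite leq_mul2r; lia.
    by rewrite -nE; lia.
  have : s * p <= (u + v + 1) * p by rewrite leq_mul2r; lia.
  by rewrite -nE; lia.
have -> : \sum_(u < s) \sum_(r < p) \sum_(b < s * p) c (u * p + r) b =
   \sum_(u < s) \sum_(r < p) (s.-1 - u) * r.
  apply: eq_bigr => u _; apply: eq_bigr => a _.
  rewrite (sum_ord_mul (c (u * p + a))).
  under eq_bigr => v _ do under eq_bigr => b _ do rewrite cE.
  rewrite -big_distrlr /= sum_ltn ?sum_geq //.
  by rewrite (leq_trans (leq_subr _ _)) ?leq_pred.
rewrite -big_distrlr /= sum_rev; congr (_ * _).
by rewrite -bin2_sum big_mkord.
Qed.

Lemma double_bin2 n : 'C(n, 2) * 2 = n * n.-1.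
Proof. by rewrite mulnC -mul_bin_diag bin1. Qed.

End Counting.

(** * Linearity of regularity, expansion in monomials, and the a-number *)

Section Regular.

Variables (K L : fieldType) (iota : {rmorphism K -> L}) (x y : L).
Variables (Omega : lmodType L) (d : L -> Omega) (P : 'I_3 -> K).

Lemma regular_at0 : regular_at iota d x y P 0.
Proof. by exists 0%N, (fun=> 0), (fun=> 0); split=> [[]|] //; rewrite big_ord0. Qed.

Lemma regular_atD w w' : regular_at iota d x y P w -> regular_at iota d x y P w' ->
  regular_at iota d x y P (w + w').
Proof.
move=> [m [f [g [lfg ->]]]] [k [f' [g' [lfg' ->]]]].
pose join (h : 'I_m -> L) (h' : 'I_k -> L) (i : 'I_(m + k)) :=
  match split i with inl j => h j | inr j => h' j end.
exists (m + k)%N, (join f f'), (join g g'); split.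
  by move=> i; rewrite /join; case: split.
rewrite big_split_ord /=; congr (_ + _); apply: eq_bigr => i _; rewrite /join.
  by rewrite -[lshift k i]/(unsplit (inl i)) unsplitK.
by rewrite -[rshift m i]/(unsplit (inr i)) unsplitK.
Qed.

End Regular.

Section Main.

Variables (K : closedFieldType) (n : nat).
Variables (L : fieldType) (iota : {rmorphism K -> L}) (x y : L).
Variables (Omega : lmodType L) (d : L -> Omega).

Lemma regular_atZ P c w : regular_at iota d x y P w ->
  regular_at iota d x y P (iota c *: w).
Proof.
move=> [m [f [g [lfg ->]]]]; exists m, (fun i => iota c * f i), g; split.
  move=> i; have [lf lg] := lfg i; split=> //.
  by apply: local_ringM => //; apply: local_ring_const.
by rewrite scaler_sumr; apply: eq_bigr => i _; rewrite scalerA.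
Qed.

Lemma homog_val m (G : {mpoly K[3]}) : G \is m.-homog -> (m + 3 <= n)%N ->
  exists c : 'I_n * 'I_n -> K, generic_val iota x y G =
    \sum_(ij : 'I_n * 'I_n | (ij.1 + ij.2 + 3 <= n)%N)
      iota (c ij) * (x ^+ ij.1 * y ^+ ij.2).
Proof.
move=> /dhomogP homG mn.
pose spanned (z : L) := exists c : 'I_n * 'I_n -> K,
  z = \sum_(ij : 'I_n * 'I_n | (ij.1 + ij.2 + 3 <= n)%N)
    iota (c ij) * (x ^+ ij.1 * y ^+ ij.2).
rewrite -/(spanned _) /generic_val /mmap big_seq.
apply: (big_ind spanned) => [|z t [b ->] [c ->]|u /homG].
- by exists (fun=> 0); rewrite big1 // => ij _; rewrite rmorph0 mul0r.
- exists (fun ij => b ij + c ij); rewrite -big_split.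
  by apply: eq_bigr => ij _; rewrite rmorphD mulrDl.
rewrite [LHS]mdeg3 mmap1_tnth3 expr1n mulr1 => udeg.
have lt0 : (u (inord 0) < n)%N by lia.
have lt1 : (u (inord 1) < n)%N by lia.
exists (fun ij => if ij == (Ordinal lt0, Ordinal lt1) then G@_u else 0).
rewrite (bigD1 (Ordinal lt0, Ordinal lt1)) /= ?eqxx; last by lia.
rewrite big1 ?addr0 // => ij /andP[_ /negPf ->]; by rewrite rmorph0 mul0r.
Qed.

End Main.

Theorem theorem3p7 (K : closedFieldType) (p s : nat)
    (charKp : p \in [pchar K]) (s_ge1 : (1 <= s)%N)
    (L : fieldType) (iota : {rmorphism K -> L}) (x y : L)
    (L_function_field :
       is_function_field iota x y (fermat_form K (s * p - 1)))
    (Omega : lmodType L) (d : L -> Omega)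
    (Omega_differentials : is_differentials iota d) :
  exists a : nat,
    is_a_number iota d p (fermat_form K (s * p - 1)) x y a /\
    a%:R = 1 / 4 * s%:R * (s%:R - 1) * p%:R * (p%:R - 1) :> rat.
Proof.
have p_prime := pcharf_prime charKp; have p_gt0 := prime_gt0 p_prime.
set n := (s * p - 1)%N in L_function_field *.
have sp : (1 < s * p)%N by rewrite (leq_trans (prime_gt1 p_prime)) // leq_pmull.
have n_gt0 : (0 < n)%N by rewrite subn_gt0.
have nE : n.+1 = (s * p)%N by rewrite /n subn1 prednK // ltnW.
have charL : p \in [pchar L] by rewrite (fmorph_pchar iota).
(* In characteristic p, [n = s p - 1] becomes -1. *)
have n_neq0 : n%:R != 0 :> L.
  have : n.+1%:R = 0 :> L by rewrite nE natrM (pcharf0 charL) mulr0.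
  by rewrite -natr1 => /eqP; rewrite addr_eq0 => /eqP ->; rewrite oppr_eq0 oner_eq0.
have Lff := L_function_field.
have [D [derD Dx Dy]] := exists_derivation n_gt0 Lff.
have [phi [phi_d _]] := Omega_differentials.2 L^o D derD.
have diffE := diff_eq n_gt0 Lff Omega_differentials n_neq0 derD Dx Dy phi_d.
have cartierE := cartier0_exact derD charL Dx (fermat_pbasis n_gt0 Lff charL nE)
  phi_d diffE.
(* [T] indexes the holomorphic monomials with zero residue, which will be the basis of the
   kernel. *)
pose T := [set ij : 'I_n * 'I_n | (ij.1 + ij.2 + 3 <= n)%N &&
  (p <= ij.1.+1 %% p + ij.2.+1 %% p)%N].
pose mon (ij : 'I_n * 'I_n) := x ^+ ij.1 * y ^+ ij.2 / y ^+ n.-1.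
have inj_val : {in predT &, injective (fun ij : 'I_n * 'I_n => (val ij.1, val ij.2))}.
  by move=> [i j] [i' j'] _ _ [] /val_inj -> /val_inj ->.
have TP (k : 'I_#|T|) : ((enum_val k).1 + (enum_val k).2 + 3 <= n)%N &&
    (p <= (enum_val k).1.+1 %% p + (enum_val k).2.+1 %% p)%N.
  by have := enum_valP k; rewrite inE.
have inj_enum : {in predT &, injective (fun k : 'I_#|T| =>
    (val (enum_val k).1, val (enum_val k).2))}.
  by move=> k l _ _ E; apply: enum_val_inj; apply: inj_val.
have phi_comb (c : 'I_#|T| -> K) :
    phi (\sum_(k < #|T|) iota (c k) *: (mon (enum_val k) *: d x)) =
    \sum_(k < #|T|) iota (c k) * mon (enum_val k).
  rewrite linear_sum; apply: eq_bigr => k _.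
  by rewrite !linearZ /= phi_d Dx /GRing.scale /= mulr1.
exists #|T|; split; last first.
  have bin2E k : (0 < k)%N -> 'C(k, 2)%:R = k%:R * (k%:R - 1) / 2 :> rat.
    move=> k_gt0; have := congr1 (fun m => m%:R : rat) (double_bin2 k).
    by rewrite !natrM -subn1 natrB // => <-; field.
  by rewrite /T (kernel_count p_gt0 nE) natrM !bin2E //; field.
exists (fun k => mon (enum_val k) *: d x); split=> [c c0 k|w].
  move: (congr1 phi c0); rewrite linear0 phi_comb => sum0.
  apply: (monomials_free n_gt0 Lff inj_enum _ _ (Q := predT) (c := c)) => // [l _|].
    have /andP[le3n _] := TP l; apply: leq_trans le3n.
    by rewrite addn3 ltnS -addn2 -addnA addnCA leq_addr.
  have yn0 : (y ^+ n.-1)^-1 != 0 by rewrite invr_eq0 expf_neq0 // (y_neq0 n_gt0 Lff).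
  apply: (mulIf yn0); rewrite mul0r mulr_suml -[RHS]sum0.
  by apply: eq_bigr => l _; rewrite -mulrA.
split=> [[hol /cartierE ex]|[c ->]]; last first.
  split.
    move=> P cP; apply: (big_ind (regular_at iota d x y P)) => [||k _].
    - exact: regular_at0.
    - exact: regular_atD.
    apply: regular_atZ.
    apply: (holomorphic_monomial n_gt0 Lff Omega_differentials n_neq0 derD Dx Dy) => //.
    by have /andP[] := TP k.
  apply/cartierE; rewrite phi_comb.
  apply/(exact_monomials n_gt0 Lff charL nE derD Dx c inj_enum) => // k _.
    by have /andP[] := TP k.
  by rewrite ltnNge; have /andP[_ ->] := TP k.
have [c wE] : exists c : 'I_n * 'I_n -> K,
    phi w = \sum_(ij : 'I_n * 'I_n | (ij.1 + ij.2 + 3 <= n)%N) iota (c ij) * mon ij.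
  have [w0|[m [G [homG mn w0]]]] :=
      holomorphic_form n_gt0 Lff Omega_differentials n_neq0 derD Dx Dy phi_d hol.
    by exists (fun=> 0); rewrite w0 linear0 big1 // => ij _; rewrite rmorph0 mul0r.
  have [c cE] := homog_val iota x y homG (eq_leq mn).
  exists c; rewrite w0 linearZ /= phi_d Dx /GRing.scale /= mulr1 cE mulr_suml.
  by apply: eq_bigr => ij _; rewrite -mulrA.
(* Exactness of [w] removes every holomorphic monomial with nonzero residue. *)
have c0 (ij : 'I_n * 'I_n) : (ij.1 + ij.2 + 3 <= n)%N -> ij \notin T -> c ij = 0.
  move=> ijn; rewrite inE ijn /= -ltnNge.
  move: ex; rewrite wE => /(exact_monomials n_gt0 Lff charL nE derD Dx c (sub_in2 _ inj_val)).
  by apply.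
exists (fun k => c (enum_val k)).
rewrite (diffE w) wE (bigID [in T]) /= [X in _ + X]big1 ?addr0; last first.
  by move=> ij /andP[ijn /(c0 _ ijn) ->]; rewrite rmorph0 mul0r.
rewrite (eq_bigl [in T]) => [|ij]; last by rewrite andb_idl // inE => /andP[].
rewrite big_enum_val scaler_suml; apply: eq_bigr => k _.
by rewrite scalerA.
Qed.
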